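(* Let $G'$ be a simple graph in which every vertex has degree one or three, and such that every bridge of $G'$ is incident to a vertex of degree one. Then $\chi'_N(G')\leq 7$, i.e., $G'$ admits a $7$-edge-coloring in which every edge not incident to a vertex of degree one is poor or rich.
   Context: A $k$-edge-coloring of a graph is an assignment of colors from $\{1,\dots,k\}$ to its edges such that adjacent edges receive different colors. For an edge-coloring $c$ and a vertex $v$, let $S_c(v)$ be the set of colors of the edges incident to $v$. An edge $xy$ whose endpoints both have degree three is poor with respect to $c$ if $|S_c(x)\cup S_c(y)|=3$ and rich if $|S_c(x)\cup S_c(y)|=5$. A normal edge-coloring of $G'$ is an edge-coloring in which every edge with both endpoints of degree three is poor or rich (no constraint is imposed on pendant edges), and $\chi'_N(G')$ is the smallest $k$ for which $G'$ admits a normal $k$-edge-coloring. *)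

(* Defs.v *)
From mathcomp Require Import all_boot.

Set Implicit Arguments.
Unset Strict Implicit.
Unset Printing Implicit Defensive.

Record sgraph := SGraph {
  vertex :> finType;
  adj : rel vertex;
  adj_sym : symmetric adj;
  adj_irr : irreflexive adj
}.

Section Graphs.
Variable G : sgraph.

Definition edges : {set {set G}} :=
  [set [set x; y] | x in [set: G], y in [set: G] & adj x y].

Definition edge : finType := {f : {set G} | f \in edges}.

Definition incident (v : G) : {set edge} := [set f : edge | v \in val f].

Definition degree (v : G) : nat := #|incident v|.

Definition del_edge (f : edge) : rel G :=
  [rel x y | adj x y && ([set x; y] != val f)].

(* [n_comp r predT] is the number of connected components of the graph with
   adjacency relation [r]: deleting a bridge increases it. *)
Definition bridge (f : edge) : bool :=
  n_comp (@adj G) predT < n_comp (del_edge f) predT.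

(* The colors 1, ..., k are represented by the elements of ['I_k]. *)
Section Colorings.
Variables (k : nat) (c : {ffun edge -> 'I_k}).

Definition edge_coloring : bool :=
  [forall f : edge, forall g : edge,
    (f != g) && (val f :&: val g != set0) ==> (c f != c g)].

Definition color_set (v : G) : {set 'I_k} := c @: incident v.

Definition poor (x y : G) : bool := #|color_set x :|: color_set y| == 3.

Definition rich (x y : G) : bool := #|color_set x :|: color_set y| == 5.

Definition normal_edge_coloring : bool :=
  edge_coloring &&
  [forall x, forall y,
    [&& adj x y, degree x == 3 & degree y == 3] ==> poor x y || rich x y].

End Colorings.

Definition normal_colorable (k : nat) : bool :=
  [exists c : {ffun edge -> 'I_k}, normal_edge_coloring c].

Lemma edge_eq (f : edge) (x y : G) :
  x != y -> x \in val f -> y \in val f -> val f = [set x; y].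
Proof.
case: f => f /= /imset2P[a b _ _ ->] nxy.
rewrite !inE => /orP[]/eqP xE /orP[]/eqP yE; rewrite xE yE ?eqxx // in nxy *.
by rewrite setUC.
Qed.

(* Giving all edges distinct colors makes every edge between vertices of
   degree three rich, so the minimum defining the index exists. *)
Lemma normal_colorable_ex : exists k, normal_colorable k.
Proof.
exists #|{: edge}|; apply/existsP; exists [ffun f => enum_rank f].
set c := finfun _.
have cI : injective c by move=> f g; rewrite !ffunE => /enum_rank_inj.
apply/andP; split.
  apply/forallP=> f; apply/forallP=> g; apply/implyP=> /andP[nfg _].
  by rewrite (inj_eq cI).
apply/forallP=> x; apply/forallP=> y.
apply/implyP=> /and3P[xy /eqP dx /eqP dy]; apply/orP; right.
have nxy : x != y by apply: contraTneq xy => ->; rewrite adj_irr.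
have xyE : [set x; y] \in edges.
  by apply/imset2P; exists x y; rewrite ?inE.
rewrite /rich -imsetU (card_imset _ cI) cardsU -!/(degree _) dx dy.
suff -> : incident x :&: incident y = [set (Sub [set x; y] xyE : edge)].
  by rewrite cards1.
apply/setP=> f; rewrite !inE; apply/andP/eqP => [[xf yf]|->].
  by apply: val_inj; rewrite /= (edge_eq nxy xf yf).
by rewrite /= !inE !eqxx orbT.
Qed.

Definition normal_chromatic_index : nat := ex_minn normal_colorable_ex.

End Graphs.

(* Main.v *)
Require Import Defs.
From mathcomp Require Import all_boot fingroup perm order.
From mathcomp Require Import ssralg ssrnum ssrint zmodp.

Set Implicit Arguments.
Unset Strict Implicit.
Unset Printing Implicit Defensive.

Import Order.TTheory GRing.Theory Num.Theory.

(** Color the edges by the seven nonzero elements of F2^3.  At a vertex where a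
nowhere-zero F2^3-flow is conserved the three colors form a line of the Fano
plane; two lines through a point are equal or meet only there, so every edge
between two such vertices is poor or rich.  If a component has no pendant edge
or at least two, Jaeger's 8-flow theorem (with the leaves identified) therefore
suffices.  It is proved here in the style of Seymour: in a 3-edge-connected
graph one grows a vertex set by closed trails, so that an even subgraph carries
the first coordinate and the other two can be made nonzero off that subgraph;
edge cuts of size two are contracted.

If a component has exactly one pendant edge, at a vertex v, no flow can be
conserved at v.  Give the two other edges at v the same flow value a, and let
w, with edges e = vw, f, g, be a neighbor of v.  When f and g are rich, the
lines at their other ends meet in a point b off the line at w; recoloring e by
a + b and giving the pendant edge color b yields a normal coloring.  Such a flow
exists unless edge cuts of size two interfere, and these are handled by
induction on vertex sets Q with exactly two boundary edges. *)

(** With a single pendant edge, summing the boundaries over all vertices except the leaf shows that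
    a flow conserved at all of them vanishes on the pendant edge; this is why conservation has to be
    given up at v.

    The two edges of a cut of size two always carry equal values. Contracting one of them is
    therefore harmless for the existence of a flow, but a cut formed by g and a further edge at the
    other end of f makes f poor in every flow; this is the obstacle behind the case analysis on such
    cuts.

    The group F2^2 of the last two coordinates enters through its four elements: a new trail is tied
    to the set already grown by two edges whose values have a prescribed sum, so at most two values
    of the first of them are forbidden. The value to spare is spent on making f rich.

    Contraction creates loops and parallel edges, so the flow part works with multigraphs given by
    two end maps [s] and [t]. Signs are essential only for the integer flows that produce closed
    trails. *)

(** * Distinctness of short lists and sets of three elements *)

Lemma uniq3E (T : eqType) (a b c : T) :
  uniq [:: a; b; c] = [&& a != b, a != c & b != c].
Proof. by rewrite /= !inE negb_or andbT -andbA. Qed.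

Lemma uniq4E (T : eqType) (a b c d : T) : uniq [:: a; b; c; d] =
  [&& a != b, a != c, a != d, b != c, b != d & c != d].
Proof. by rewrite /= !inE !negb_or andbT -!andbA. Qed.

Lemma uniq5E (T : eqType) (a b c d e : T) : uniq [:: a; b; c; d; e] =
  [&& a != b, a != c, a != d, a != e, b != c, b != d, b != e, c != d, c != e
    & d != e].
Proof. by rewrite /= !inE !negb_or andbT -!andbA. Qed.

Lemma uniq4W (T : eqType) (a b c d : T) :
  uniq [:: a; b; c; d] -> uniq [:: a; b; c].
Proof. by rewrite uniq4E uniq3E => /and5P[-> -> _ ->]. Qed.

Lemma uniq4CA (T : eqType) (a b c d : T) :
  uniq [:: a; b; c; d] -> uniq [:: a; c; b; d].
Proof.
by rewrite !uniq4E (eq_sym c b) => /and5P[-> -> -> -> /andP[-> ->]].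
Qed.

Lemma card_set3 (T : finType) (a b c : T) :
  uniq [:: a; b; c] -> #|[set a; b; c]| = 3.
Proof.
move=> u3; rewrite -[3]/(size [:: a; b; c]) -(card_uniqP u3).
by apply: eq_card => x; rewrite !inE orbA.
Qed.

Lemma imset_set3 (T U : finType) (f : T -> U) a b c :
  f @: [set a; b; c] = [set f a; f b; f c].
Proof. by rewrite !imsetU !imset_set1. Qed.

Lemma inj_set3 (T U : finType) (f : T -> U) a b c :
  uniq [:: f a; f b; f c] -> {in [set a; b; c] &, injective f}.
Proof.
move=> u3; apply/imset_injP; rewrite imset_set3 !card_set3 //.
by apply: (map_uniq (f := f)).
Qed.

Lemma big_set3 (E : finType) (A : zmodType) (phi : E -> A) (a b c : E) :
  uniq [:: a; b; c] ->
  (\sum_(x in [set a; b; c]) phi x = phi a + phi b + phi c)%R.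
Proof.
rewrite /= !inE negb_or andbT => /andP[/andP[ab ac] bc].
have cab : c \notin [set a; b] by rewrite !inE negb_or ![c == _]eq_sym ac.
by rewrite setUC big_setU1 //= big_setU1 ?inE //= big_set1 addrC.
Qed.

(** * Boundaries and closed trails in multigraphs *)

Section Boundary.
Local Open Scope ring_scope.
Variables (V E : finType) (s t : E -> V).

Definition cut (A : {set V}) : {set E} := [set x | (s x \in A) != (t x \in A)].

Definition inner (A : {set V}) : {set E} := [set x | (s x \in A) && (t x \in A)].

Lemma in_cut1 (u : V) (x : E) :
  (x \in cut [set u]) = (s x == u) (+) (t x == u).
Proof. by rewrite !inE; case: (s x == u); case: (t x == u). Qed.

Definition boundary (A : zmodType) (phi : E -> A) (u : V) : A :=
  \sum_(x | s x == u) phi x - \sum_(x | t x == u) phi x.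

Local Notation bd := boundary.

Section Zmod.
Variable A : zmodType.
Implicit Types phi psi : E -> A.

Lemma eq_bd phi psi u : phi =1 psi -> bd phi u = bd psi u.
Proof. by move=> eq; rewrite /boundary; congr (_ - _); apply: eq_bigr => x _. Qed.

Lemma bdD phi psi u : bd (fun x => phi x + psi x) u = bd phi u + bd psi u.
Proof. by rewrite /boundary !big_split /= opprD addrACA. Qed.

Lemma bd_sum (I : finType) (P : pred I) (F : I -> E -> A) u :
  bd (fun x => \sum_(i | P i) F i x) u = \sum_(i | P i) bd (F i) u.
Proof.
by rewrite /boundary sumrB; congr (_ - _); apply: exchange_big.
Qed.

Lemma bd0 u : bd (fun=> 0 : A) u = 0.
Proof. by rewrite /boundary !big1 ?subr0. Qed.

Lemma bd_delta y (a : A) u :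
  bd (fun x => if x == y then a else 0) u =
  (if s y == u then a else 0) - (if t y == u then a else 0).
Proof.
have delta (P : pred E) : \sum_(x | P x) (if x == y then a else 0) =
    if P y then a else 0.
  rewrite big_mkcond (bigD1 y) //= eqxx big1 ?addr0 // => x /negPf ->.
  by rewrite if_same.
by rewrite /boundary !delta.
Qed.

Lemma sum_bd (X : {set V}) phi :
  \sum_(u in X) bd phi u =
  \sum_(x | s x \in X) phi x - \sum_(x | t x \in X) phi x.
Proof.
rewrite /boundary sumrB; congr (_ - _).
  rewrite (partition_big s [in X]) //=; apply: eq_bigr => u uX.
  by apply: eq_bigl => x; case: eqP => [->|]; rewrite ?uX ?andbF.
rewrite (partition_big t [in X]) //=; apply: eq_bigr => u uX.
by apply: eq_bigl => x; case: eqP => [->|]; rewrite ?uX ?andbF.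
Qed.

Lemma sum_bd_cut (X : {set V}) phi :
  \sum_(u in X) bd phi u =
  \sum_(x in cut X) (if s x \in X then phi x else - phi x).
Proof.
rewrite sum_bd [X in X - _]big_mkcond [X in _ - X]big_mkcond -sumrB.
rewrite [RHS]big_mkcond; apply: eq_bigr => x _; rewrite inE.
by case: (s x \in X); case: (t x \in X); rewrite /= ?subrr ?subr0 ?sub0r.
Qed.

Lemma bd_out (X : {set V}) phi u :
  (forall x, x \notin inner X -> phi x = 0) -> u \notin X -> bd phi u = 0.
Proof.
move=> phi0 uX; rewrite /boundary !big1 ?subr0 // => x /eqP xu; apply: phi0;
  by rewrite inE xu (negPf uX) ?andbF.
Qed.

End Zmod.

Section Char2.
Variable A : zmodType.
Hypothesis char2 : forall a : A, a + a = 0.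
Implicit Types phi psi : E -> A.

Lemma oppr_char2 (a : A) : - a = a.
Proof. by apply/eqP; rewrite eq_sym -addr_eq0 char2. Qed.

Lemma addr_eq0_char2 (a b : A) : (a + b == 0) = (a == b).
Proof. by rewrite addr_eq0 oppr_char2. Qed.

Lemma addKr_char2 (a b : A) : a + (a + b) = b.
Proof. by rewrite addrA char2 add0r. Qed.

Lemma addrK_char2 (a b : A) : a + b + b = a.
Proof. by rewrite -addrA char2 addr0. Qed.

Lemma uniq_line (a b : A) : a != 0 -> b != 0 -> a != b ->
  uniq [:: 0; a; b; a + b].
Proof.
move=> a0 b0 ab; have ab0 : a + b != 0 by rewrite addr_eq0_char2.
have [a_ab b_ab] : a != a + b /\ b != a + b.
  rewrite -{1}[a]addr0 (inj_eq (addrI _)) -{2}[b]add0r (inj_eq (addIr _)).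
  by rewrite ![0 == _]eq_sym.
by rewrite uniq4E ![0 == _]eq_sym a0 b0 ab0 ab a_ab b_ab.
Qed.

(** After the recoloring [w] sees e + b, f and g. The three lists are the unions of this set with
    the lines {f, b, f + b}, {g, b, g + b} and {e + b, e, b}; five distinct entries mean that the
    three edges at [w] become rich. *)
Lemma recolor_uniq (e f g b : A) : e = f + g -> uniq [:: 0; f; g] ->
  b \notin [:: 0; f; g; e] ->
  [/\ uniq [:: f; e + b; g; b; f + b], uniq [:: g; e + b; f; b; g + b]
    & uniq [:: e + b; f; g; e; b]].
Proof.
move=> ->; rewrite uniq3E !inE !negb_or => /and3P[f0 g0 fg].
case/and4P=> b0 bf bg bfg; rewrite ![0 == _]eq_sym in f0 g0.
have sub0 (x y : A) : (x != y) = (x + y != 0) by rewrite addr_eq0_char2.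
have fgb : f + g + b != 0 by rewrite addr_eq0_char2 eq_sym.
have u5P (x1 x2 x3 x4 x5 : A) :
    [/\ x1 + x2 != 0, x1 + x3 != 0, x1 + x4 != 0 & x1 + x5 != 0] ->
    [/\ x2 + x3 != 0, x2 + x4 != 0 & x2 + x5 != 0] ->
    x3 + x4 != 0 /\ x3 + x5 != 0 -> x4 + x5 != 0 ->
    uniq [:: x1; x2; x3; x4; x5].
  case=> h12 h13 h14 h15 [h23 h24 h25] [h34 h35] h45.
  by rewrite uniq5E; do ![apply/andP; split]; rewrite sub0.
have [fg0 gf0] : f + g != 0 /\ g + f != 0 by rewrite [g + f]addrC -sub0.
have fb0 : f + b != 0 by rewrite addrC -sub0.
have gb0 : g + b != 0 by rewrite addrC -sub0.
have k1 (x y : A) : x + (x + y) = y by rewrite addKr_char2.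
have k3 (x y : A) : x + y + y = x by rewrite addrK_char2.
have a1 : f + (f + g + b) = g + b by rewrite -addrA k1.
have a2 : g + (f + g + b) = f + b by rewrite (addrC f) -addrA k1.
have a3 : f + g + b + g = f + b by rewrite addrC a2.
have a4 : f + g + b + f = g + b by rewrite addrC a1.
have a5 : f + g + b + (f + b) = g by rewrite (addrC f) -(addrA g) k3.
have a6 : f + g + b + (g + b) = f by rewrite -(addrA f) k3.
have a7 (x : A) : b + (x + b) = x by rewrite addrC k3.
have a8 : f + g + b + (f + g) = b by rewrite addrC k1.
have a9 : g + (f + g) = f by rewrite addrC k3.
have c1 : f + (g + b) != 0 by rewrite addrA.
have c2 : g + (f + b) != 0 by rewrite addrCA.
split; apply: u5P.
- by rewrite a1 k1.
- by rewrite a3 k3 a5.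
- by [].
- by rewrite a7.
- by rewrite a2 k1.
- by rewrite a4 k3 a6.
- by [].
- by rewrite a7.
- by rewrite a4 a3 a8 k3.
- by rewrite k1.
- by rewrite a9.
- by [].
Qed.

Lemma sum_bd_cut2 (X : {set V}) phi :
  \sum_(u in X) bd phi u = \sum_(x in cut X) phi x.
Proof.
by rewrite sum_bd_cut; apply: eq_bigr => x _; case: ifP; rewrite ?oppr_char2.
Qed.

Lemma bd_cut1 phi u : bd phi u = \sum_(x in cut [set u]) phi x.
Proof. by rewrite -sum_bd_cut2 big_set1. Qed.

(** Conservation is imposed on all vertex sets because cuts, unlike stars, pull back along
    contractions. In characteristic two no signs occur, and [flowP] gives the equivalence with
    conservation at vertices. *)
Definition flow phi := forall X, \sum_(x in cut X) phi x = 0.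

Lemma flowP phi : (forall u, bd phi u = 0) <-> flow phi.
Proof.
split=> [bd0 X|fl u]; last by rewrite bd_cut1.
by rewrite -sum_bd_cut2 big1.
Qed.

End Char2.

Lemma cutC (X : {set V}) : cut (~: X) = cut X.
Proof. by apply/setP=> x; rewrite !inE; case: (s x \in X); case: (t x \in X). Qed.

Definition symd (X Y : {set V}) : {set V} := [set u | (u \in X) (+) (u \in Y)].

Lemma cut_symd X Y x : (x \in cut (symd X Y)) = (x \in cut X) (+) (x \in cut Y).
Proof.
rewrite !inE; by case: (s x \in X); case: (t x \in X);
  case: (s x \in Y); case: (t x \in Y).
Qed.

End Boundary.

(** * Integer flows and augmenting paths *)

Section Augment.
Local Open Scope ring_scope.
Variables (V E : finType) (s t : E -> V) (D : {set E}).
Implicit Types (theta : E -> int) (p q u v : V).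

Local Notation bd := (boundary s t).
Local Notation cut := (cut s t).

(** Every edge of [D] has capacity one in both directions: under the unit bound it can take one more
    unit forwards unless it carries 1, and backwards unless it carries -1. *)
Definition residual theta : rel V := fun u v =>
  [exists x in D, [&& s x == u, t x == v & theta x <= 0]
               || [&& t x == u, s x == v & 0 <= theta x]].

Definition unit_bounded theta := forall x, `|theta x| <= (x \in D)%:R.

Definition dif (p q : V) (u : V) : int := (u == p)%:R - (u == q)%:R.

(** The last clause carries the induction: the rest of the path avoids [u], so the first edge still
    has its old value when it is changed after the others. *)
Lemma push theta (r : seq V) u :
  unit_bounded theta -> path (residual theta) u r -> uniq (u :: r) ->
  exists theta', [/\ unit_bounded theta',
    forall v, bd theta' v = bd theta v + dif u (last u r) v &
    forall x, ~~ ((s x \in u :: r) && (t x \in u :: r)) -> theta' x = theta x].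
Proof.
move=> bnd; elim: r u => [|v r IH] u /=.
  move=> _ _; exists theta; split=> // v.
  by rewrite /dif subrr addr0.
case/andP=> /existsP[x /andP[xD res]] pr /andP[uvr uniq_r].
have [th [bnd1 bd1 eq1]] := IH _ pr uniq_r.
have thx : th x = theta x.
  apply: eq1; case/orP: res => /and3P[/eqP-> /eqP-> _]; by rewrite (negPf uvr) ?andbF.
pose e : int := if (s x == u) && (theta x <= 0) then 1 else -1.
have nuv : u != v by move: uvr; rewrite inE; case/norP.
exists (fun y => th y + (if y == x then e else 0)); split.
- move=> y; case: (eqVneq y x) => [->|_]; last by rewrite addr0; apply: bnd1.
  have := bnd x; rewrite thx xD /e.
  case/orP: res => /and3P[/eqP xu /eqP xv].
    rewrite xu eqxx /= => le0; rewrite le0; move: le0.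
    by move: (theta x) => -[[|[|n]]|[|n]].
  rewrite xv eq_sym (negPf nuv) /=.
  by move: (theta x) => -[[|[|n]]|[|n]].
- move=> w; rewrite bdD bd1 bd_delta -!addrA; congr (_ + _).
  rewrite /dif /e; case/orP: res => /and3P[/eqP -> /eqP ->].
    move=> ->; rewrite eqxx /= ![_ == w]eq_sym.
    by case: (w == u); case: (w == v); case: (w == _).
  move=> _; rewrite (eq_sym v u) (negPf nuv) /= ![_ == w]eq_sym.
  by case: (w == u); case: (w == v); case: (w == _).
- move=> y; rewrite !inE => out.
  rewrite eq1; last first.
    apply: contra out; rewrite !inE => /andP[-> ->]; by rewrite !orbT.
  case: eqP => [yx|_]; last by rewrite addr0.
  case/negP: out; rewrite yx.
  by case/orP: res => /and3P[/eqP -> /eqP -> _]; rewrite !eqxx !orbT.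
Qed.

(* The vertices reachable in the residual graph form a cut all of whose edges
   are saturated outwards, so there are only [k] of them unless [q] is reached. *)
Lemma augment theta p q (k : nat) :
  unit_bounded theta -> (forall v, bd theta v = dif p q v *+ k) ->
  (forall X : {set V}, p \in X -> q \notin X -> k < #|D :&: cut X|)%N ->
  exists theta', unit_bounded theta' /\ forall v, bd theta' v = dif p q v *+ k.+1.
Proof.
move=> bnd bdk cuts.
have [/connectP[r pr lastr]|npq] := boolP (connect (residual theta) p q).
  case/shortenP: pr lastr => r' pr' uniq_r' _ lastr.
  have [th [bnd1 bd1 _]] := push bnd pr' uniq_r'.
  by exists th; split=> // v; rewrite bd1 bdk -lastr mulrSr.
pose X := [set u | connect (residual theta) p u].
have pX : p \in X by rewrite inE connect0.
have qX : q \notin X by rewrite inE.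
suff cardE : (#|D :&: cut X|%:Z = k%:Z).
  by have := cuts X pX qX; case: cardE => ->; rewrite ltnn.
have <- : \sum_(u in X) bd theta u = k%:Z.
  rewrite (eq_bigr _ (fun v _ => bdk v)) (bigD1 p) //= big1 ?addr0.
    have /negPf pq : p != q by apply: contraNneq qX => <-.
    by rewrite /dif eqxx pq subr0 -mulr_natl mulr1 natz.
  move=> u /andP[uX /negPf up]; rewrite /dif up.
  have /negPf -> : u != q by apply: contraNneq qX => <-.
  by rewrite subrr mul0rn.
rewrite sum_bd_cut -natz -sum1_card natr_sum big_mkcond [RHS]big_mkcond.
apply: eq_bigr => x _; rewrite inE; case: (boolP (x \in cut X)); last by rewrite andbF.
rewrite andbT => xX; case: ifP => xD; last first.
  have := bnd x; rewrite xD normr_le0 => /eqP ->.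
  by rewrite oppr0 if_same.
have nres u v : u \in X -> v \notin X -> ~~ residual theta u v.
  rewrite !inE => pu; apply: contra => uv; exact: connect_trans (connect1 uv).
move: xX; rewrite inE; case: ifP => sx.
  move=> tx; have /existsPn/(_ x) := nres _ _ sx tx; rewrite xD !eqxx /=.
  case/norP; move: (theta x) (bnd x); rewrite xD => -[[|[|n]]|[|n]] //.
case tx: (t x \in X) => // _.
have /existsPn/(_ x) := nres _ _ tx (negbT sx); rewrite xD !eqxx /=.
by case/norP => _; move: (theta x) (bnd x); rewrite xD => -[[|[|n]]|[|n]].
Qed.

End Augment.

(** * Connectivity inside an edge set and closed trails *)

Section Circuit.
Local Open Scope ring_scope.
Variables (V E : finType) (s t : E -> V).
Implicit Types (F D : {set E}) (p q u v : V) (W X : {set V}).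

Local Notation bd := (boundary s t).
Local Notation cut := (cut s t).
Local Notation inner := (inner s t).

Definition erel F : rel V := fun u v =>
  [exists x in F, (s x == u) && (t x == v) || (t x == u) && (s x == v)].

Lemma erel_cut F X u v :
  u \in X -> v \notin X -> erel F u v -> exists2 x, x \in F & x \in cut X.
Proof.
move=> uX vX /existsP[x /andP[xF uv]]; exists x => //; rewrite inE.
by case/orP: uv => /andP[/eqP -> /eqP ->]; rewrite uX (negPf vX).
Qed.

Lemma connect_cut F X u v :
  u \in X -> v \notin X -> connect (erel F) u v ->
  exists2 x, x \in F & x \in cut X.
Proof.
move=> uX vX /connectP[r]; elim: r u uX => [|w r IH] u uX /=.
  by move=> _ vu; rewrite vu uX in vX.
case/andP=> uw pr lr; have [wX|wX] := boolP (w \in X); first exact: (IH w).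
exact: erel_cut uX wX uw.
Qed.

Definition reach F p : {set V} := [set u | connect (erel F) p u].

Lemma reach_cut F p x : x \in F -> x \notin cut (reach F p).
Proof.
move=> xF; have st : erel F (s x) (t x).
  by apply/existsP; exists x; rewrite xF !eqxx.
have ts : erel F (t x) (s x).
  by apply/existsP; exists x; rewrite xF !eqxx orbT.
rewrite !inE negbK; apply/eqP; apply/idP/idP => pu;
  by apply: connect_trans pu (connect1 _).
Qed.

Lemma reach_sub F p X :
  p \in X -> {in F, forall x, x \notin cut X} -> reach F p \subset X.
Proof.
move=> pX noF; apply/subsetP=> u; rewrite inE => pu.
apply/negPn/negP => uX; have [x xF] := connect_cut pX uX pu.
exact/negP/noF.
Qed.

Section Solve.
Variable A : zmodType.

Lemma path_solve F p u (a : A) : connect (erel F) p u ->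
  exists2 eta : E -> A, (forall x, x \notin F -> eta x = 0) &
  forall v, bd eta v = (if v == u then a else 0) - (if v == p then a else 0).
Proof.
case/connectP=> r; elim: r p => [|w r IH] p /=.
  by move=> _ ->; exists (fun=> 0) => // v; rewrite bd0 subrr.
case/andP=> /existsP[x /andP[xF pw]] pr lr.
have [eta eta0 bdeta] := IH _ pr lr.
exists (fun y => eta y + (if y == x then if s x == p then - a else a else 0)).
  move=> y yF; rewrite eta0 // add0r; case: eqP => // yx.
  by rewrite yx xF in yF.
move=> v; rewrite bdD bdeta bd_delta -addrA; congr (_ + _).
have simp := (opprK, oppr0, addr0, add0r, addNr, subrr).
case/orP: pw => /andP[/eqP -> /eqP ->]; rewrite ![_ == v]eq_sym ?eqxx.
  by case: (v == p); case: (v == w); rewrite ?simp.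
rewrite (eq_sym w p); case: (eqVneq p w) => [->|_].
  by case: (v == w); rewrite ?simp.
by case: (v == p); case: (v == w); rewrite ?simp.
Qed.

(** Send [b u] from [p] to each [u] of [W] along a path in [F]; the amounts leaving [p] add up to
    zero. *)
Lemma solve F p W (b : V -> A) :
  W \subset reach F p -> \sum_(u in W) b u = 0 ->
  exists2 eta : E -> A, (forall x, x \notin F -> eta x = 0) &
  forall v, bd eta v = if v \in W then b v else 0.
Proof.
move=> /subsetP Wp sumb.
have ex u : exists eta : E -> A, (forall x, x \notin F -> eta x = 0) /\
    (u \in W -> forall v,
      bd eta v = (if v == u then b u else 0) - (if v == p then b u else 0)).
  have [uW|uW] := boolP (u \in W); last by exists (fun=> 0); split.
  have := Wp u uW; rewrite inE => /(path_solve (b u))[eta eta0 bdeta].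
  by exists eta.
have [eta etaP] := fin_all_exists ex.
exists (fun x => \sum_(u in W) eta u x).
  by move=> x xF; rewrite big1 // => u _; apply: (etaP u).1.
move=> v; rewrite bd_sum.
rewrite (eq_bigr _ (fun u uW => (etaP u).2 uW v)) sumrB.
have -> : \sum_(u in W) (if v == p then b u else 0) = 0.
  by case: (v == p); rewrite ?big1_eq.
rewrite subr0; case: ifP => vW.
  by rewrite (bigD1 v) //= eqxx big1 ?addr0 // => u /andP[_ /negPf];
    rewrite eq_sym => ->.
by rewrite big1 // => u uW; case: eqP vW => [->|//]; rewrite uW.
Qed.

End Solve.

Definition supp (A : zmodType) (c : E -> A) : {set E} := [set x | c x != 0].

Lemma charF2 (a : 'F_2) : a + a = 0.
Proof. by case: a => [[|[|m]] i]; apply/val_inj. Qed.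

(** Menger for two edge-disjoint paths, in flow form: two augmentations give a flow of value 2 with
    values in -1, 0, 1. Modulo 2 its boundary vanishes and its support is unchanged. If the support
    did not connect [p] to [q], the set reached from [p] would have net outflow 2 but no edge of the
    support in its cut. *)
Lemma trail D p q :
  (forall X : {set V}, p \in X -> q \notin X -> 1 < #|D :&: cut X|)%N ->
  exists c : E -> 'F_2, [/\ forall u, bd c u = 0,
    {subset supp c <= D} & q \in reach (supp c) p].
Proof.
move=> cuts.
have [th1 [bnd1 bd1]] : exists th, unit_bounded D th /\
    forall v, bd th v = dif p q v *+ 1.
  apply: (@augment _ _ s t D (fun=> 0)) => [x|v|X pX qX].
  - by rewrite normr0 ler0n.
  - by rewrite bd0.
  - exact: ltn_trans (cuts X pX qX).
have [th [bnd bdth]] := augment bnd1 bd1 cuts.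
pose c x : 'F_2 := (th x)%:~R.
have c0 x : c x = 0 -> th x = 0.
  rewrite /c; have : `|th x| <= 1.
    by apply: le_trans (bnd x) _; case: (x \in D).
  by case: (th x) => -[|[|n]].
exists c; split.
- move=> u; have -> : bd c u = (bd th u)%:~R :> 'F_2.
    by rewrite /boundary rmorphB !rmorph_sum.
  by rewrite bdth mulr2n rmorphD charF2.
- move=> x; rewrite inE; apply: contraR => xD; rewrite /c.
  have := bnd x; rewrite (negPf xD) normr_le0 => /eqP ->; exact: eqxx.
apply/negPn/negP => qW; set W := reach _ _ in qW.
have pW : p \in W by rewrite inE connect0.
have := sum_bd_cut s t W th; rewrite [RHS]big1 => [|x xW].
  rewrite (bigD1 p) //= big1 ?addr0 => [|u /andP[uW /negPf up]].
    have /negPf pq : p != q by apply: contraNneq qW => <-.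
    by rewrite bdth /dif eqxx pq.
  have /negPf uq : u != q by apply: contraNneq qW => <-.
  by rewrite bdth /dif up uq subrr mul0rn.
suff -> : th x = 0 by rewrite oppr0 if_same.
apply/c0/eqP; apply: contraLR xW => cx; apply: reach_cut; by rewrite inE.
Qed.

(* Two vertices that no single edge of [X] separates lie on a common closed
   trail in [X]; the trail is given by its edge set, the support of [c]. *)
Lemma circuit X p q :
  p \in X ->
  (forall Y : {set V}, p \in Y -> q \notin Y -> 1 < #|inner X :&: cut Y|)%N ->
  exists (c : E -> 'F_2) (W : {set V}),
    [/\ forall u, bd c u = 0, p \in W, q \in W, W \subset X &
      {subset supp c <= inner W} /\ W \subset reach (supp c) p].
Proof.
move=> pX cuts; have [c [bdc cX qW]] := trail cuts.
have [W WE] : exists W, W = reach (supp c) p by exists (reach (supp c) p).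
(* Only the component of the support that contains [p] is kept, so that the new support lies inside
   [W] and connects it. *)
rewrite -WE in qW; pose d x := if s x \in W then c x else 0.
have pW : p \in W by rewrite WE inE connect0.
have stW x : c x != 0 -> (s x \in W) = (t x \in W).
  move=> cx; apply/eqP; have := @reach_cut (supp c) p x.
  by rewrite inE cx -WE => /(_ isT); rewrite inE negbK.
exists d, W; split=> //.
- move=> u; have [uW|uW] := boolP (u \in W).
    rewrite -(bdc u) /boundary; congr (_ - _); apply: eq_bigr => x /eqP xu.
      by rewrite /d xu uW.
    by rewrite /d; have [->|/stW ->] := eqVneq (c x) 0; rewrite ?if_same // xu uW.
  rewrite /boundary !big1 ?subr0 // => x /eqP xu; last by rewrite /d xu (negPf uW).
  by rewrite /d; have [->|/stW ->] := eqVneq (c x) 0; rewrite ?if_same // xu (negPf uW).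
- rewrite WE; apply: reach_sub => // x /cX; rewrite !inE => /andP[-> ->]; exact: negbT.
split=> [x|]; rewrite /d.
  by rewrite !inE; case: ifP => [sx cx|]; rewrite ?eqxx // -stW // sx.
apply/subsetP=> u; rewrite {1}WE inE => /connectP[r pr ->] {u}.
rewrite inE; clear - pW pr stW.
elim: r p pW pr => [|v r IH] u uW /=; first by rewrite connect0.
case/andP=> uv pr; have vW : v \in W.
  apply: contraT => vW; have [x] := erel_cut uW vW uv.
  by rewrite !inE => /stW ->; rewrite eqxx.
apply: connect_trans (IH _ vW pr); apply: connect1.
case/existsP: uv => x /andP[cx uv]; apply/existsP; exists x; rewrite uv andbT.
move: cx; rewrite !inE => cx; case: ifP => //; rewrite (stW _ cx).
by case/orP: uv => /andP[/eqP xu /eqP xv]; rewrite ?xu ?xv ?uW ?vW.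
Qed.

End Circuit.

(** * The 8-flow theorem *)

Section Growth.
Local Open Scope ring_scope.
Variables (V E : finType) (s t : E -> V).
Hypothesis conn3 : forall X : {set V}, X != set0 -> X != setT ->
  (2 < #|cut s t X|)%N.
Implicit Types (W X S : {set V}).

Local Notation bd := (boundary s t).
Local Notation cut := (cut s t).
Local Notation inner := (inner s t).
Local Notation reach := (reach s t).

Definition between X S : {set E} :=
  [set x | (s x \in X) && (t x \in S) || (t x \in X) && (s x \in S)].

(* Take a minimal nonempty [X] disjoint from [S] sending at most one edge to the
   remaining vertices: by minimality no single edge separates [X], and since all
   cuts have at least three edges, two edges [y], [z] join [X] to [S]. *)
Lemma grow S : S != set0 -> S != setT ->
  exists (c : E -> 'F_2) (W : {set V}) (w : V) (y z : E),
    [/\ [disjoint S & W], forall u, bd c u = 0, {subset supp c <= inner W},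
      w \in W /\ W \subset reach (supp c) w &
      [/\ y != z, y \in between S W & z \in between S W]].
Proof.
move=> S0 ST; pose P X := [&& X != set0, X \subset ~: S &
  (#|between X (~: S :\: X)| <= 1)%N].
have PS : P (~: S).
  rewrite /P subxx setDv -subset0 -[set0]setCK setCS setC0 subTset ST /=.
  rewrite (_ : between _ _ = set0) ?cards0 //.
  by apply/setP=> x; rewrite !inE !andbF.
have [X /minsetP[/and3P[X0 XS bX] minX] _] := minset_exists PS.
set R := ~: S :\: X in bX.
have inS u : u \in X -> u \in S = false.
  by move=> uX; have := subsetP XS u uX; rewrite inE => /negPf.
have XT : X != setT.
  case/set0Pn: S0 => u uS; apply: contraTneq uS => XT; by rewrite inS // XT.
have bSX : (1 < #|between S X|)%N.
  have : cut X \subset between S X :|: between X R.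
    apply/subsetP=> x; rewrite !inE.
    by case: (s x \in X); case: (t x \in X); case: (s x \in S);
      case: (t x \in S).
  move/subset_leq_card; rewrite leqNgt => cardU.
  rewrite ltnNge; apply: contra cardU => bS.
  apply: leq_ltn_trans (leq_card_setU _ _) _.
  apply: leq_ltn_trans (leq_add bS bX) _.
  exact: conn3.
have [y [z [yb zb yz]]] := card_gt1P bSX.
pose xend y := if s y \in X then s y else t y.
have xendX v : v \in between S X -> xend v \in X.
  rewrite inE /xend; case: ifP => // sX; by case/orP=> /andP[].
have cuts (Y : {set V}) : xend y \in Y -> xend z \notin Y ->
    (1 < #|inner X :&: cut Y|)%N.
  move=> yY zY; rewrite ltnNge; apply/negP => small.
  (* A proper part of [X] joined to the rest of [X] by at most one edge must send an edge to [R], or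
     it would be a smaller candidate. Both sides of [Y] do so, and two edges from [X] to [R] are too
     many. *)
  have half (B : {set V}) : X :&: B != set0 -> X :&: B != X -> cut B = cut Y ->
      exists x, x \in between (X :&: B) R.
    move=> B0 BX cB; apply/set0Pn; rewrite -card_gt0 ltnNge; apply/negP => b0.
    case/negP: BX; apply/eqP; apply: minX; last exact: subsetIl.
    rewrite /P B0 /= (subset_trans (subsetIl _ _) XS) /=.
    have : between (X :&: B) (~: S :\: (X :&: B)) \subset
        (inner X :&: cut Y) :|: between (X :&: B) R.
      apply/subsetP=> x; rewrite -cB !inE.
      case sX: (s x \in X); case tX: (t x \in X);
        case sB: (s x \in B); case tB: (t x \in B) => //=;
        by case: (s x \in S); case: (t x \in S).
    move/subset_leq_card/leq_trans; apply.
    apply: leq_trans (leq_card_setU _ _) _.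
    by rewrite -[1%N]addn0 leq_add.
  have yX := xendX _ yb; have zX := xendX _ zb.
  have [||//|x1 x1b] := half Y.
  - by apply/set0Pn; exists (xend y); rewrite inE yX.
  - by apply/eqP => /setP/(_ (xend z)); rewrite inE zX (negPf zY).
  have [|||x2 x2b] := half (~: Y).
  - by apply/set0Pn; exists (xend z); rewrite !inE zX.
  - by apply/eqP => /setP/(_ (xend y)); rewrite !inE yX yY.
  - exact: cutC.
  move: bX; apply/negP; rewrite -ltnNge; apply/card_gt1P; exists x1, x2.
  move: x1b x2b; rewrite !inE; split.
  - by case/orP: x1b => /andP[/andP[-> _] /andP[-> ->]]; rewrite ?orbT.
  - by case/orP: x2b => /andP[/andP[-> _] /andP[-> ->]]; rewrite ?orbT.
  apply: contraTneq x2b => <-.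
  by case/orP: x1b => /andP[/andP[-> ->] /andP[/negPf -> _]]; rewrite ?andbF.
have [c [W [bdc yW zW WX [cW Wc]]]] := circuit (xendX _ yb) cuts.
exists c, W, (xend y), y, z; split=> //.
  rewrite disjoint_sym; apply/pred0P => u /=; apply/negP => /andP[uW].
  by rewrite inS // (subsetP WX).
have attach v : v \in between S X -> xend v \in W -> v \in between S W.
  rewrite !inE /xend; case: ifP => [sX|sX].
    by case/orP => /andP[vS vX] ->; [rewrite inS in vS|rewrite vS orbT].
  by rewrite andbF orbF => /andP[-> _] ->.
by split=> //; apply: attach.
Qed.

(** * Choosing the remaining coordinates off the circuits *)

Section Avoid.
Variable A : zmodType.
Hypothesis char2 : forall a : A, a + a = 0.
Hypothesis avoid3 : forall a b c : A, exists d, [/\ d != a, d != b & d != c].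
Implicit Types (c : E -> 'F_2) (forb psi : E -> A) (b : V -> A).

(** A free demand [b] lets the problem be solved in pieces: values already fixed elsewhere turn into
    a demand on [S]. With [S] everything, [b] and [forb] zero and [c] conserved, [c] and [psi] form
    a nowhere-zero flow. *)
Definition solves S c forb b psi := [/\ forall x, x \notin inner S -> psi x = 0,
  forall u, u \in S -> bd psi u = b u &
  forall x, x \in inner S -> c x = 0 -> psi x != forb x].

Lemma between_cut S W x : [disjoint S & W] -> x \in between S W ->
  x \in cut W /\ x \notin inner S.
Proof.
move=> dSW; have nW u : u \in S -> u \in W = false.
  by move=> uS; apply: (disjointFr dSW).
by rewrite !inE; case/orP=> /andP[uS uW]; rewrite uW (nW _ uS) uS;
  split=> //=; apply: contraL uW => uS'; rewrite nW //; case/andP: uS'.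
Qed.

(* The edges of the trail absorb any boundary on [W], so only [y] and [z] have
   to be chosen; their values have prescribed sum [beta]. *)
Lemma step S W cS c w y z forb b :
  [disjoint S & W] -> {subset supp cS <= inner S} ->
  {subset supp c <= inner W} -> W \subset reach (supp c) w ->
  y != z -> y \in between S W -> z \in between S W ->
  \sum_(u in S :|: W) b u = 0 ->
  exists beta psib, forall gam, gam != forb y -> beta + gam != forb z ->
  exists psi0 b', [/\ \sum_(u in S) b' u = 0,
    forall psi, solves S cS forb b' psi ->
      solves (S :|: W) (fun x => cS x + c x) forb b (fun x => psi0 x + psi x),
    psi0 y = gam & forall x, c x = 0 -> x != y -> x != z -> psi0 x = psib x].
Proof.
move=> dSW cSS cW Wc yz yb zb sumb.
have [d [d0 _ _]] := avoid3 0 0 0.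
have [yW yS] := between_cut dSW yb; have [zW zS] := between_cut dSW zb.
have out x : x \in between S W -> x \in inner (S :|: W).
  by rewrite !inE; case/orP=> /andP[-> ->]; rewrite ?orbT.
have ncut c' x : {subset supp c' <= inner W} -> x \notin inner W ->
    c' x = 0 :> 'F_2.
  by move=> c'W; apply: contraNeq => c'x; apply: c'W; rewrite inE.
have dW u : u \in W -> u \in S = false by apply: disjointFl.
have dS u : u \in S -> u \in W = false by apply: disjointFr.
have cutin x : x \in cut W -> x \notin inner W.
  by rewrite !inE; case: (s x \in W); case: (t x \in W).
have cSin x : x \in inner S -> c x = 0.
  by move=> xS; apply: ncut cW _; move: xS; rewrite !inE => /andP[/dS -> _].
pose new x := [&& x \in inner (S :|: W), x \notin inner S, c x == 0,
  x != y & x != z].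
pose psib x := if new x then forb x + d else 0.
(* [beta] is what remains to be balanced over [W]. Both [y] and [z] cross the cut of [W], so the
   values [gam] and [beta + gam] given to them contribute exactly [beta]; the demand left has total
   zero and the trail absorbs it. *)
pose beta := \sum_(u in W) (b u + bd psib u).
(* Neither [beta] nor [psib] depends on [gam]: the values for two choices of [gam] differ only at
   [y], [z] and on the trail. *)
exists beta, psib => gam gy gz.
pose phi x := psib x + ((if x == y then gam else 0) +
  (if x == z then beta + gam else 0)).
have sumW : \sum_(u in W) (b u + bd phi u) = 0.
  have delta v (a : A) : v \in cut W ->
      \sum_(u in W) bd (fun x => if x == v then a else 0) u = a.
    move=> vW; rewrite sum_bd_cut2 // (bigD1 v) //= eqxx big1 ?addr0 //.
    by move=> x /andP[_ /negPf ->].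
  under eq_bigr => u _ do rewrite !bdD addrA.
  by rewrite big_split /= -/beta big_split /= !delta // (addrC beta gam)
    (addKr_char2 char2) char2.
have [eta eta0 bdeta] := solve Wc sumW.
pose psi0 x := phi x + eta x.
have psi0out x : x \notin inner (S :|: W) -> psi0 x = 0.
  move=> xo; rewrite /psi0 /phi /psib /new (negPf xo) /= add0r.
  rewrite eta0 ?addr0; last first.
    apply: contra xo => /cW; rewrite !inE => /andP[-> ->]; by rewrite !orbT.
  have nx v : v \in between S W -> (x == v) = false.
    by move=> vb; apply: contraNF xo => /eqP ->; apply: out.
  by rewrite !nx // addr0.
have bdW u : u \in W -> bd psi0 u = b u.
  by move=> uW; rewrite bdD bdeta uW addrC addrK_char2.
exists psi0, (fun u => b u + bd psi0 u); split.
- have : \sum_(u in S :|: W) (b u + bd psi0 u) = 0.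
    rewrite big_split /= sumb add0r sum_bd_cut2 // big1 // => x xc.
    apply: psi0out; move: xc; rewrite ![_ \in cut _]inE ![_ \in inner _]inE.
    by case: (s x \in _); case: (t x \in _).
  rewrite (eq_bigl [predU S & W]); last by move=> u; rewrite !inE.
  rewrite bigU //= [X in _ + X]big1 ?addr0 // => u uW.
  by rewrite bdW // char2.
- move=> psi [psi_out bdpsi psi_forb]; split.
  + move=> x xo; rewrite psi0out // psi_out ?addr0 //.
    by apply: contra xo; rewrite !inE => /andP[-> ->].
  + move=> u; rewrite inE bdD; have [uS _|uS /= uW] := boolP (u \in S).
      by rewrite bdpsi // (addrC (b u)) addKr_char2.
    by rewrite bdW // (bd_out psi_out uS) addr0.
  + move=> x xi; have [xS|xS] := boolP (x \in inner S).
      rewrite cSin // addr0 => cx.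
      suff -> : psi0 x = 0 by rewrite add0r; apply: psi_forb.
      rewrite /psi0 /phi /psib /new xS andbF add0r eta0; last first.
        by rewrite inE cSin ?eqxx.
      case: eqP xS => [->|_]; first by rewrite (negPf yS).
      by case: eqP => [->|_]; rewrite ?(negPf zS) // !addr0.
    have -> : cS x = 0 by apply: contraNeq xS => cx; apply: cSS; rewrite inE.
    rewrite add0r psi_out // addr0 => cx.
    rewrite /psi0 eta0 ?addr0; last by rewrite inE cx eqxx.
    rewrite /phi /psib /new xi xS cx eqxx /=.
    case: (eqVneq x y) => [->|xy] /=; first by rewrite (negPf yz) add0r addr0.
    case: (eqVneq x z) => [->|xz] /=; first by rewrite !add0r.
    by rewrite !addr0 -subr_eq0 addrAC subrr add0r.
- rewrite /psi0 eta0; last by rewrite inE negbK (ncut c) ?cutin.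
  by rewrite /phi /psib /new eqxx /= !andbF (negPf yz) add0r !addr0.
- move=> x cx xy xz; rewrite /psi0 eta0; last by rewrite inE cx eqxx.
  by rewrite /phi (negPf xy) (negPf xz) !addr0.
Qed.

(** Circuits are added outwards from [S], but values are chosen inwards: the last circuit comes
    first, and each passes a demand of total zero to the set inside it. The innermost problem is
    left open so that [flow_avoiding] can solve it in two ways. *)
Lemma extend S cS : S != set0 ->
  (forall u, bd cS u = 0) -> {subset supp cS <= inner S} ->
  exists c, [/\ forall u, bd c u = 0, {in inner S, c =1 cS} &
    forall forb, exists psi0 b', \sum_(u in S) b' u = 0 /\
      forall psi, solves S cS forb b' psi ->
        solves setT c forb (fun=> 0) (fun x => psi0 x + psi x)].
Proof.
have [k] := ubnP #|~: S|; elim: k => // k IH in S cS *; rewrite ltnS => Sk.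
move=> S0 bdcS cSS; have [ST|ST] := eqVneq S setT.
  exists cS; split=> // forb; exists (fun=> 0), (fun=> 0).
  split=> [|psi [h1 h2 h3]]; first by rewrite big1.
  rewrite ST in h1 h2 h3; split=> [x xi|u uT|x xi cx].
  - by rewrite h1 ?addr0.
  - by rewrite bdD bd0 h2 ?addr0.
  - by rewrite add0r h3.
have [c [W [w [y [z [dSW bdc cW [wW Wc] [yz yb zb]]]]]]] := grow S0 ST.
have small : (#|~: (S :|: W)| < k)%N.
  apply: leq_trans Sk; apply: proper_card; rewrite properC properUl //.
  apply/subsetPn; exists w => //; by rewrite (disjointFl dSW).
have sub : {subset inner S <= inner (S :|: W)}.
  by move=> x; rewrite !inE => /andP[-> ->].
have subW : {subset inner W <= inner (S :|: W)}.
  by move=> x; rewrite !inE => /andP[-> ->]; rewrite !orbT.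
have cSin x : x \in inner S -> c x = 0.
  move=> xS; apply: contraTeq (isT) => cx.
  have /cW : x \in supp c by rewrite inE.
  move: xS; rewrite !inE => /andP[sS _] /andP[sW _].
  by rewrite (disjointFr dSW sS) in sW.
have [|||c' [bdc' c'S ext]] := IH (S :|: W) (fun x => cS x + c x) small.
- by case/set0Pn: S0 => u uS; apply/set0Pn; exists u; rewrite inE uS.
- by move=> u; rewrite bdD bdcS bdc addr0.
- move=> x; rewrite inE; have [/cSS xS _|cx] := boolP (x \in supp cS).
    exact: sub.
  move: cx; rewrite inE negbK => /eqP ->; rewrite add0r => cx.
  by apply/subW/cW; rewrite inE.
exists c'; split=> // [x xS|forb].
  by rewrite c'S ?sub // cSin ?addr0.
have [psi1 [b1 [sumb1 ext1]]] := ext forb.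
have [beta [psib st]] := step forb dSW cSS cW Wc yz yb zb sumb1.
have [gam [gy gz _]] := avoid3 (forb y) (beta + forb z) 0.
have [|psi0 [b' [sumb' sol _ _]]] := st gam gy.
  by apply: contra_neq gz => <-; rewrite addKr_char2.
exists (fun x => psi1 x + psi0 x), b'; split=> // psi /sol/ext1[h1 h2 h3].
split=> [x xi|u uT|x xi cx]; [by rewrite -addrA h1| |by rewrite -addrA h3].
by rewrite -(h2 u uT); apply: eq_bd => x; rewrite addrA.
Qed.

(** Edges inside a single vertex are loops, as contraction produces them; they do not affect the
    boundary, so any value off [forb] will do. *)
Lemma base_solves u forb : exists psi, forall b, b u = 0 ->
  solves [set u] (fun=> 0) forb b psi.
Proof.
have [d [d0 _ _]] := avoid3 0 0 0.
exists (fun x => if x \in inner [set u] then forb x + d else 0) => b bu; split.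
- by move=> x /negPf ->.
- move=> v; rewrite inE => /eqP ->; rewrite bu (bd_cut1 _ _ char2).
  rewrite big1 // => x; rewrite !inE; by case: (s x == _); case: (t x == _).
- by move=> x -> _; rewrite -subr_eq0 addrAC subrr add0r.
Qed.

Lemma eight_flow (u : V) : exists (c : E -> 'F_2) (psi : E -> A),
  [/\ forall v, bd c v = 0, forall v, bd psi v = 0 &
    forall x, c x = 0 -> psi x != 0].
Proof.
have [|v|x|c [bdc _ ext]] := @extend [set u] (fun=> 0).
- by apply/set0Pn; exists u; rewrite inE.
- exact: bd0.
- by rewrite inE eqxx.
have [psi0 [b' [sumb' sol]]] := ext (fun=> 0).
rewrite big_set1 in sumb'; have [psi psiP] := base_solves u (fun=> 0).
have [_ bdpsi psi0'] := sol _ (psiP _ sumb').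
exists c, (fun x => psi0 x + psi x); split=> // [v|x cx].
  by rewrite bdpsi ?inE.
by apply: psi0' => //; rewrite !inE.
Qed.

(* The circuit through [w] avoids [w2], hence uses [e] and [f]; the edges [g]
   and [m] then join it to [w2] and leave two values for [g]. *)
Lemma flow_avoiding w w2 e f g m n :
  uniq [:: e; f; g] -> uniq [:: g; m; n] ->
  cut [set w] = [set e; f; g] -> cut [set w2] = [set g; m; n] ->
  e \notin cut [set w2] -> m \notin cut [set w] ->
  exists c : E -> 'F_2, [/\ forall v, bd c v = 0, c e != 0 /\ c f != 0,
    c g = 0 /\ c m = 0 &
    forall x, c x = 0 -> x != g -> exists psi : E -> A,
      [/\ forall v, bd psi v = 0, forall y, c y = 0 -> psi y != 0 &
        psi x != psi g]].
Proof.
move=> uniqw uniqw2 cutw cutw2 ew2 mw.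
pose X := ~: [set w2].
pose r := if s m == w2 then t m else s m.
have ww2 : w != w2.
  by apply: contraNneq ew2 => <-; rewrite cutw !inE eqxx.
have gw : g \in cut [set w] by rewrite cutw !inE eqxx !orbT.
have gw2 : g \in cut [set w2] by rewrite cutw2 !inE eqxx.
have mw2 : m \in cut [set w2] by rewrite cutw2 !inE eqxx !orbT.
have rw2 : r != w2.
  by move: mw2; rewrite in_cut1 /r; case: (eqVneq (s m) w2).
have rw : r != w.
  apply: contraNneq mw => rw; rewrite in_cut1; move: mw2; rewrite in_cut1.
  move: rw; rewrite /r; case: eqP => [sw2 ->|sw2 -> /eqP ->] /=.
    by rewrite sw2 (eq_sym w2) (negPf ww2) eqxx.
  by rewrite eqxx (eq_sym w2) (negPf ww2).
have cuts (Y : {set V}) : w \in Y -> r \notin Y -> (1 < #|inner X :&: cut Y|)%N.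
  move=> wY rY; rewrite ltnNge; apply/negP => small.
  (* [Z] agrees with [Y] except possibly at [w2]. Of the at least three edges in its cut at most one
     avoids [w2], so two are at [w2]. For [Y] without and with [w2] the edges found at [w2] are
     complementary, which would need four edges there. *)
  have half (Z : {set V}) : w \in Z -> r \notin Z -> Z :\ w2 = Y :\ w2 ->
      (1 < #|cut [set w2] :&: cut Z|)%N.
    move=> wZ rZ ZY; have : (2 < #|cut Z|)%N.
      apply: conn3; first by apply/set0Pn; exists w.
      by apply: contraNneq rZ => ->; rewrite inE.
    have /subset_leq_card : cut Z \subset
        (inner X :&: cut Y) :|: (cut [set w2] :&: cut Z).
      apply/subsetP=> x; rewrite !inE; move/setP: ZY => ZY.
      have := ZY (s x); have := ZY (t x); rewrite !inE.
      case: (eqVneq (s x) w2) => [->|_]; case: (eqVneq (t x) w2) => [->|_] /=;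
        by [rewrite eqxx | move=> _ _ -> | move=> -> -> ->].
    move=> le1 /leq_trans/(_ le1); rewrite ltnNge => gt2.
    rewrite ltnNge; apply: contra gt2 => small2.
    apply: leq_trans (leq_card_setU _ _) _.
    by rewrite -[2%N]/(1 + 1)%N leq_add.
  have h1 : (1 < #|cut [set w2] :&: cut (Y :\ w2)|)%N.
    by apply: half; rewrite ?inE ?ww2 ?(negPf rY) ?andbF //;
      apply/setP=> u; rewrite !inE; case: eqP.
  have h2 : (1 < #|cut [set w2] :\: cut (Y :\ w2)|)%N.
    have -> : cut [set w2] :\: cut (Y :\ w2) = cut [set w2] :&: cut (w2 |: Y).
      apply/setP=> x; rewrite !inE; by case: (s x == w2);
        case: (t x == w2); case: (s x \in Y); case: (t x \in Y).
    by apply: half; rewrite ?inE ?wY ?orbT // ?negb_or ?rw2 //;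
      apply/setP=> u; rewrite !inE; case: eqP.
  have := leq_add h1 h2; rewrite cardsID cutw2.
  by rewrite ltnNge (leq_trans (leq_card_setU _ _)) // cards1 addn1 ltnS
    (leq_trans (leq_card_setU _ _)) // !cards1.
have wX : w \in X by rewrite !inE.
have [c [W [bdc wW rW WX [cW Wc]]]] := circuit wX cuts.
have w2W : w2 \notin W.
  by apply/negP => /(subsetP WX); rewrite !inE eqxx.
have dW : [disjoint [set w2] & W] by rewrite disjoints1.
have cutwW x : x \in cut [set w2] -> c x = 0.
  move=> xw2; apply: contraTeq xw2 => cx.
  have /cW : x \in supp c by rewrite inE.
  rewrite in_cut1 inE => /andP[sW tW].
  have nw2 u : u \in W -> (u == w2) = false.
    by move=> uW; apply: contraTF uW => /eqP ->.
  by rewrite !nw2.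
have gb : g \in between [set w2] W.
  move: gw gw2; rewrite !in_cut1 !inE.
  by case: eqP => [->|_]; case: eqP => [->|_] //=; rewrite ?wW ?orbT ?andbT;
   move=> _; rewrite ?(negPf ww2) ?addbF //= => ->; rewrite ?orbT.
have mb : m \in between [set w2] W.
  move: mw2 rW; rewrite in_cut1 !inE /r.
  by case: eqP => //= [_ _ ->|_ ->] //= ->.
have gm : g != m by case/and3P: uniqw2; rewrite inE negb_or => /andP[].
pose S := [set w2] :|: W.
have inS x : x \in inner W -> x \in inner S.
  by rewrite !inE => /andP[-> ->]; rewrite !orbT.
have inSb x : x \in between [set w2] W -> x \in inner S.
  by rewrite !inE => /orP[] /andP[-> ->]; rewrite !orbT.
(* The summand 0 matches the shape [cS x + c x] in [step], with [cS] zero. *)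
pose c1 x := 0 + c x.
have [|v|x|c' [bdc' c'S ext]] := @extend S c1.
- by apply/set0Pn; exists w2; rewrite !inE eqxx.
- by rewrite bdD bd0 bdc addr0.
- rewrite inE /c1 add0r => cx; apply/inS/cW; by rewrite inE.
have flow_w : c e + c f = 0.
  have := bdc w; rewrite (bd_cut1 _ _ charF2) cutw big_set3 //.
  by rewrite (cutwW g) ?addr0.
have efc x : x \in [:: e; f] -> c x != 0.
  move=> xef; apply/negP => cx0.
  have cef : c e = 0 /\ c f = 0.
    move: xef flow_w; rewrite !inE => /orP[]/eqP xE; rewrite xE in cx0.
      by rewrite (eqP cx0) add0r.
    by rewrite (eqP cx0) addr0.
  have wr : connect (erel s t (supp c)) w r.
    by have := subsetP Wc r rW; rewrite inE.
  have rw' : r \notin [set w] by rewrite inE.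
  have [y ysupp] := connect_cut (set11 w) rw' wr.
  move: ysupp; rewrite inE => cy; rewrite cutw !inE.
  by case/orP=> [/orP[]|] /eqP yE; move: cy; rewrite yE ?cef.1 ?cef.2 ?eqxx //
    cutwW ?eqxx.
have cc' x : c x != 0 -> c' x != 0.
  by move=> cx; rewrite c'S /c1 ?add0r // inS // cW // inE.
have c'g : c' g = 0 by rewrite c'S ?inSb // /c1 add0r cutwW.
have c'm : c' m = 0 by rewrite c'S ?inSb // /c1 add0r cutwW.
have c'n : c' n = 0.
  have := bdc' w2; rewrite (bd_cut1 _ _ charF2) cutw2 big_set3 //.
  by rewrite c'g c'm !add0r.
exists c'; split=> //; first by split; apply/cc'/efc; rewrite !inE eqxx ?orbT.
move=> x c'x xg.
have [psi1 [b1 [sumb1 ext1]]] := ext (fun=> 0).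
have c00 : {subset supp (fun=> 0 : 'F_2) <= inner [set w2]}.
  by move=> y; rewrite inE eqxx.
have [beta [psib st]] := step (fun=> 0) dW c00 cW Wc gm gb mb sumb1.
(* Of the four values only 0 and [beta] are forbidden for [gam], so two choices remain. *)
have [ga [ga0 gab _]] := avoid3 0 beta 0.
have [gb' [gb0 gbb gba]] := avoid3 0 beta ga.
have [psi2 sol2] := base_solves w2 (fun=> 0).
have sol gam : gam != 0 -> gam != beta -> exists psi0,
   [/\ solves setT c' (fun=> 0) (fun=> 0) (fun y => psi1 y + (psi0 y + psi2 y)),
     psi0 g = gam &
     forall y, c y = 0 -> y != g -> y != m -> psi0 y = psib y].
  move=> gam0 gamb; have [|psi0 [b' [sumb' sol p0g p0]]] := st gam gam0.
    by rewrite (addr_eq0_char2 char2) eq_sym.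
  exists psi0; split=> //; apply/ext1/sol/sol2.
  by rewrite big_set1 in sumb'.
have [p1 [[_ bd1 nz1] p1g p1eq]] := sol ga ga0 gab.
have [p2 [[_ bd2 nz2] p2g p2eq]] := sol gb' gb0 gbb.
have res (psi : E -> A) : (forall u, u \in [set: V] -> bd psi u = 0) ->
    (forall y, y \in inner setT -> c' y = 0 -> psi y != 0) ->
    psi x != psi g -> exists psi : E -> A,
      [/\ forall v, bd psi v = 0, forall y, c' y = 0 -> psi y != 0 &
        psi x != psi g].
  by move=> h1 h2 h3; exists psi; split=> // *; [apply: h1|apply: h2];
    rewrite ?inE.
pose q1 y := psi1 y + (p1 y + psi2 y); pose q2 y := psi1 y + (p2 y + psi2 y).
(* Equal values at [m] and [g] would, by conservation at [w2], leave 0 on [n], where [c'] vanishes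
   as well. *)
have [xm|xm] := eqVneq x m.
  apply: (res q1) => //; rewrite xm.
  have qn : q1 n != 0 by apply: nz1; rewrite ?inE.
  apply: contraNneq qn => qm; have := bd1 w2 (in_setT _).
  by rewrite (bd_cut1 _ _ char2) cutw2 big_set3 // -/(q1 _) -/(q1 m) -/(q1 n) qm
    char2 add0r => ->.
have cx : c x = 0.
  have [xS|xS] := boolP (x \in inner S).
    by move: c'x; rewrite c'S // /c1 add0r.
  by apply: contraNeq xS => cx; apply/inS/cW; rewrite inE.
(* The two solutions agree at [x], which is off the trail, but differ at [g], so at least one of
   them separates the two edges. *)
have q12 : q1 x = q2 x by rewrite /q1 /q2 p1eq ?p2eq.
have [q1x|q1x] := eqVneq (q1 x) (q1 g); last exact: (res q1).
apply: (res q2) => //; rewrite -q12 q1x /q1 /q2 p1g p2g.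
by rewrite (inj_eq (addrI _)) (inj_eq (addIr _)) eq_sym.
Qed.

End Avoid.

End Growth.

(** * Contraction of edge cuts of size two *)

Section Contraction.
Local Open Scope ring_scope.

Lemma cut_preim (V V' E : finType) (s t : E -> V) (rho : V -> V') X :
  cut (rho \o s) (rho \o t) X = cut s t (rho @^-1: X).
Proof. by apply/setP=> x; rewrite !inE. Qed.

Lemma sum_symd (V E : finType) (s t : E -> V) (A : zmodType)
    (char2 : forall a : A, a + a = 0) (phi : E -> A) X Y :
  \sum_(x in cut s t (symd X Y)) phi x =
  \sum_(x in cut s t X) phi x + \sum_(x in cut s t Y) phi x.
Proof.
rewrite big_mkcond [X in X + _]big_mkcond [X in _ + X]big_mkcond -big_split.
apply: eq_bigr => x _ /=; rewrite cut_symd.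
by case: (x \in cut s t X); case: (x \in cut s t Y); rewrite ?addr0 ?add0r
  ?char2.
Qed.

Lemma cut_symd2 (V E : finType) (s t : E -> V) X Y (x y z : E) :
  x != y -> z != y -> x != z ->
  cut s t X = [set x; y] -> cut s t Y = [set y; z] ->
  cut s t (symd X Y) = [set x; z].
Proof.
move=> xy zy xz cX cY; apply/setP=> v; rewrite cut_symd cX cY !inE.
have [->|vy] := eqVneq v y.
  by rewrite orbT /= (eq_sym y) (negPf xy) (eq_sym y) (negPf zy).
by rewrite orbF /=; have [->|] := eqVneq v x; rewrite ?(negPf xz).
Qed.

(* A contracted edge [x] takes its flow value from [r x], with which it forms an
   edge cut. *)
Lemma contract (E : finType) (K : {set E}) (V : finType) (s t : E -> V) :
  (forall X : {set V}, X != set0 -> X != setT -> (1 < #|cut s t X|)%N) ->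
  (forall (X : {set V}) x y, x \in K -> y \in K -> x != y ->
     cut s t X <> [set x; y]) ->
  exists (V' : finType) (rho : V -> V') (r : E -> E),
  [/\ forall X : {set V'}, X != set0 -> X != setT ->
        (2 < #|cut (rho \o s) (rho \o t) X|)%N,
      forall w, cut s t [set w] \subset K -> forall u, rho u = rho w -> u = w,
      forall x, r x != x -> exists X : {set V}, cut s t X = [set x; r x],
      {in K, r =1 id} &
      forall (A : zmodType), (forall a : A, a + a = 0) -> forall phi : E -> A,
        flow (rho \o s) (rho \o t) phi -> flow s t (phi \o r)].
Proof.
have [k] := ubnP #|V|; elim: k => // k IH in V s t *; rewrite ltnS => Vk.
move=> conn noK.
have [/existsP[X /and3P[X0 XT cX]]|no2] :=
  boolP [exists X : {set V}, [&& X != set0, X != setT & #|cut s t X| == 2]];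
  last first.
  exists V, id, id; split=> // [X X0 XT|x]; last by rewrite eqxx.
  rewrite ltn_neqAle conn // andbT eq_sym; apply: contra no2 => cX.
  by apply/existsP; exists X; rewrite X0 XT.
(* The two edges of the cut are not both in [K], so the edge to be contracted can be taken outside
   [K]. *)
have [c [c' [cc' cXE cK]]] : exists c c', [/\ c != c', cut s t X = [set c; c'] &
    c \notin K].
  case/cards2P: (cX) => c [c' [cc' cXE]].
  have [cK|cK] := boolP (c \in K); last by exists c, c'.
  exists c', c; split; [by rewrite eq_sym|by rewrite setUC|].
  by apply/negP => c'K; apply: (noK X c c').
have cXc : c \in cut s t X by rewrite cXE !inE eqxx.
have stc : t c != s c.
  by apply: contraTneq cXc => tsc; rewrite inE tsc eqxx.
pose V1 : finType := {u : V | u != s c}.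
pose rho1 (u : V) : V1 := insubd (Sub (t c) stc) u.
have rho1E u : val (rho1 u) = if u != s c then u else t c by rewrite val_insubd.
have rho1K v : rho1 (val v) = v by apply: valKd.
pose s1 := rho1 \o s; pose t1 := rho1 \o t.
have V1k : (#|V1| < k)%N.
  apply: leq_trans Vk; rewrite card_sig; apply: proper_card.
  apply/properP; split; first exact/subsetP.
  by exists (s c) => //; rewrite !inE eqxx.
have c1 (X1 : {set V1}) : c \notin cut s1 t1 X1.
  rewrite inE negbK; apply/eqP; congr (_ \in X1); apply: val_inj.
  by rewrite /= !rho1E eqxx stc.
have [|X1 x y xK yK xy|V' [rho [r [conn' rhoK r2 rK rflow]]]] :=
    IH V1 s1 t1 V1k.
- move=> X1 X10 X1T; rewrite cut_preim; apply: conn.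
    by case/set0Pn: X10 => v vX; apply/set0Pn; exists (val v); rewrite inE rho1K.
  apply: contraNneq X1T => /setP XE; apply/eqP/setP=> v; have := XE (val v).
  by rewrite !inE rho1K.
- by rewrite cut_preim; apply: noK.
pose r1 x := if x == c then c' else x.
exists V', (rho \o rho1), (r \o r1); split=> //.
- move=> w wK u /= ruw.
  have cw : c \notin cut s t [set w] by apply: contra cK; apply: (subsetP wK).
  have [sw tw] : s c != w /\ t c != w.
    have : (s c == w) = (t c == w) by move: cw; rewrite in_cut1; do 2!case: (_ == w).
    have [sw|sw <-] := eqVneq (s c) w; last by [].
    by move/esym/eqP => tw; case/eqP: (stc); rewrite tw.
  have pre : rho1 @^-1: [set rho1 w] = [set w].
    apply/setP=> v; rewrite !inE -val_eqE /= !rho1E (eq_sym w) sw.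
    by have [->|] := eqVneq v (s c); rewrite ?(negPf sw) ?(negPf tw).
  have := rhoK (rho1 w); rewrite cut_preim pre => /(_ wK _ ruw) r1uw.
  by apply/set1P; rewrite -pre !inE r1uw.
- move=> x; rewrite /= /r1; case: (eqVneq x c) => [->|xc] rx; last first.
    by have [X1 cX1] := r2 x rx; exists (rho1 @^-1: X1); rewrite -cut_preim.
  have [rc'|rc'] := eqVneq (r c') c'; first by exists X; rewrite rc'.
  have [X1 cX1] := r2 c' rc'; exists (symd X (rho1 @^-1: X1)).
  by apply: cut_symd2 cXE _; rewrite -?cut_preim // eq_sym.
- move=> x xK; rewrite /= /r1; case: eqP => [xc|_]; last exact: rK.
  by rewrite -xc xK in cK.
- move=> A char2 phi /(rflow A char2) fl.
  (* A cut not separating the ends of [c] is a cut of the contracted graph. Any other cut becomes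
     one after taking the symmetric difference with [X], whose cut has sum zero because [c] takes
     the value of [c']. *)
  have same (Y : {set V}) : (s c \in Y) = (t c \in Y) ->
      \sum_(x in cut s t Y) phi (r (r1 x)) = 0.
    move=> stY; have YE : cut s t Y = cut s1 t1 (val @^-1: Y).
      rewrite cut_preim; congr (cut s t _); apply/setP=> u; rewrite !inE rho1E.
      by case: eqVneq => // ->.
    rewrite YE; apply: etrans (fl (val @^-1: Y)).
    apply: eq_bigr => x xY.
    rewrite /r1; case: eqP xY => // ->; by rewrite (negPf (c1 _)).
  move=> Y; have [/same //|stY] := eqVneq (s c \in Y) (t c \in Y).
  have := sum_symd s t char2 (fun x => phi (r (r1 x))) Y X.
  rewrite same; last first.
    move: stY cXc; rewrite !inE.
    by case: (s c \in Y); case: (t c \in Y); case: (s c \in X); case: (t c \in X).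
  rewrite cXE big_setU1 ?inE //= big_set1 /r1 eqxx eq_sym (negPf cc') char2 addr0.
  by move=> <-.
Qed.

End Contraction.

(** * The groups F2, F2^2 and F2^3 *)

Section Colors.
Local Open Scope ring_scope.

Lemma char2B2 (a : 'F_2 * 'F_2) : a + a = 0.
Proof. by case: a => a b; congr (_, _); apply: charF2. Qed.

Lemma char2B3 (a : 'F_2 * ('F_2 * 'F_2)) : a + a = 0.
Proof. by case: a => a b; congr (_, _); [apply: charF2|apply: char2B2]. Qed.

Lemma avoid3B2 (a b c : 'F_2 * 'F_2) : exists d, [/\ d != a, d != b & d != c].
Proof.
have /subsetPn[d _] : ~~ ([set: 'F_2 * 'F_2] \subset [set a; b; c]).
  apply/negP => /subset_leq_card; rewrite cardsT card_prod card_ord.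
  move/leq_trans/(_ (leq_card_setU _ _)); rewrite cards1 addn1 ltnS.
  by move/leq_trans/(_ (leq_card_setU _ _)); rewrite !cards1.
by rewrite !inE !negb_or => /andP[/andP[da db] dc]; exists d.
Qed.

Lemma F2_neq0 (a b : 'F_2) : a != 0 -> b != 0 -> a + b = 0.
Proof.
by case: a b => [[|[|m]] i] [[|[|n]] j] // _ _; apply: val_inj.
Qed.

End Colors.

Local Notation color := ('F_2 * ('F_2 * 'F_2))%type.

(** * Flows conserved on a vertex set, its complement being contracted *)

Section Quotient.
Local Open Scope ring_scope.
Variables (V E : finType) (s t : E -> V) (Q : {set V}).
Implicit Types (X Y : {set V}) (x y : E).

Local Notation bd := (boundary s t).
Local Notation cutQ := (cut ((insub : V -> option {u : V | u \in Q}) \o s)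
  (insub \o t)).
Local Notation cutV := (cut s t).
Local Notation inner := (inner s t).

Hypothesis cutsQ : forall X, X \subset Q -> X != set0 -> (1 < #|cutV X|)%N.

(* [insub] contracts the complement of [Q] to the vertex [None]. *)
Local Notation VQ := (option {u : V | u \in Q}).
Local Notation toQ := (insub : V -> VQ).

Lemma preimQ (X : {set VQ}) : None \notin X -> toQ @^-1: X \subset Q.
Proof.
move=> nX; apply/subsetP=> u; rewrite inE; case: insubP => // _.
by rewrite (negPf nX).
Qed.

Lemma cutQ_sub (X : {set VQ}) : exists2 Y : {set V}, Y \subset Q & cutQ X = cutV Y.
Proof.
have [nX|nX] := boolP (None \in X).
  exists (toQ @^-1: (~: X)); last by rewrite -cut_preim cutC.
  by apply: preimQ; rewrite inE nX.
by exists (toQ @^-1: X); [apply: preimQ|rewrite -cut_preim].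
Qed.

Lemma connQ (X : {set VQ}) : X != set0 -> X != setT -> (1 < #|cutQ X|)%N.
Proof.
suff nonempty (Y : {set VQ}) : None \notin Y -> Y != set0 -> (1 < #|cutQ Y|)%N.
  move=> X0 XT; have [nX|/nonempty] := boolP (None \in X); last exact.
  rewrite -cutC; apply: nonempty; first by rewrite inE nX.
  by rewrite -subset0 -[set0]setCK setCS setC0 subTset.
move=> nY /set0Pn[v vY]; rewrite cut_preim; apply: cutsQ; first exact: preimQ.
case: v vY => [v|] vY; last by rewrite vY in nY.
by apply/set0Pn; exists (val v); rewrite inE valK.
Qed.

Lemma cutQ1 u : u \in Q -> cutQ [set toQ u] = cutV [set u].
Proof.
move=> uQ; rewrite cut_preim; congr (cutV _); apply/setP=> v; rewrite !inE.
apply/eqP/eqP => [|-> //]; rewrite (insubT [in Q] uQ).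
by case: insubP => // w vQ <- [->].
Qed.

Lemma flowQ (A : zmodType) (char2 : forall a : A, a + a = 0) (phi : E -> A) :
  flow (toQ \o s) (toQ \o t) phi -> forall u, u \in Q -> bd phi u = 0.
Proof. by move=> fl u uQ; rewrite (bd_cut1 _ _ char2) -cutQ1. Qed.

Lemma flow_pair (V' : finType) (s' t' : E -> V') (c : E -> 'F_2)
    (psi : E -> 'F_2 * 'F_2) :
  (forall v, boundary s' t' c v = 0) -> (forall v, boundary s' t' psi v = 0) ->
  flow s' t' (fun x => (c x, psi x) : color).
Proof.
move=> /(flowP _ _ charF2) flc /(flowP _ _ char2B2) flpsi X.
have pairD (P : pred E) : \sum_(x | P x) ((c x, psi x) : color) =
    (\sum_(x | P x) c x, \sum_(x | P x) psi x).
  by elim/big_rec3: _ => // x a b d _ ->.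
by rewrite pairD flc flpsi.
Qed.

(** Two contractions: the complement of [Q] becomes one vertex, where nothing is claimed, and then
    edge cuts of size two disappear. The 8-flow found there lifts back, and contracted edges inherit
    nonzero values. *)
Lemma nz_flow : exists phi : E -> color,
  (forall u, u \in Q -> bd phi u = 0) /\ forall x, phi x != 0.
Proof.
have [|V' [rho [r [conn3 _ _ _ lift]]]] := @contract E set0 _ _ _ connQ.
  by move=> X x y; rewrite inE.
have [c [psi [bdc bdpsi nz]]] := eight_flow conn3 char2B2 avoid3B2 (rho None).
exists (fun x => (c (r x), psi (r x))); split=> [|x].
  exact: (flowQ char2B3 (lift _ char2B3 _ (flow_pair bdc bdpsi))).
rewrite -pair_eqE /= /pair_eq /= negb_and.
by case: eqVneq => //= /nz.
Qed.

(** The first coordinate is 1 on [e] and [f] and 0 on [g] and [m], which settles [m]. Conservation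
    at [w1] makes it 0 on exactly one of [h], [k]; that edge differs from [e] in the first
    coordinate and can be made to differ from [g] in the others. Excluding the listed cuts keeps [w]
    and [w2] from being merged with other vertices, and [h] and [k] from being tied to the value of
    [g]. *)
Lemma rich_flow w w1 w2 e f g h k m n :
  w \in Q -> w1 \in Q -> w2 \in Q ->
  uniq [:: e; f; g] -> uniq [:: f; h; k] -> uniq [:: g; m; n] ->
  cutV [set w] = [set e; f; g] -> cutV [set w1] = [set f; h; k] ->
  cutV [set w2] = [set g; m; n] ->
  e \notin cutV [set w2] -> m \notin cutV [set w] -> h != g -> k != g ->
  (forall X x y, X \subset Q -> x \in [set e; f; g] :|: [set m; n] ->
     y \in [set e; f; g] :|: [set m; n] -> x != y -> cutV X <> [set x; y]) ->
  (forall X, X \subset Q -> cutV X <> [set h; g]) ->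
  (forall X, X \subset Q -> cutV X <> [set k; g]) ->
  exists phi : E -> color, [/\ forall u, u \in Q -> bd phi u = 0,
    forall x, phi x != 0, phi h != phi e /\ phi h != phi g &
    phi m != phi e /\ phi m != phi f].
Proof.
set K := [set e; f; g] :|: [set m; n] => wQ w1Q w2Q uw uw1 uw2 cw cw1 cw2.
move=> ew2 mw hg kg noK nohg nokg.
have [|V' [rho [r [conn3 single r2 rK lift]]]] := @contract E K _ _ _ connQ.
  by move=> X x y xK yK xy; have [Y YQ ->] := cutQ_sub X; apply: noK.
have cutK u : u \in Q -> cutV [set u] \subset K ->
    cut (rho \o (toQ \o s)) (rho \o (toQ \o t)) [set rho (toQ u)] =
    cutV [set u].
  move=> uQ uK; rewrite cut_preim -cutQ1 //; congr (cut _ _ _).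
  apply/setP=> v; rewrite !inE; apply/eqP/eqP => [|-> //].
  by apply: single; rewrite cutQ1 ?inE.
have wK : cutV [set w] \subset K by rewrite cw subsetUl.
have w2K : cutV [set w2] \subset K.
  rewrite cw2; apply/subsetP=> x; rewrite !inE.
  by case/orP=> [/orP[]|] /eqP ->; rewrite eqxx ?orbT.
have [c [bdc [ce cf] [cg cm] avoid]] : exists c : E -> 'F_2,
    [/\ forall v, boundary (rho \o (toQ \o s)) (rho \o (toQ \o t)) c v = 0,
    c e != 0 /\ c f != 0, c g = 0 /\ c m = 0 &
    forall x, c x = 0 -> x != g -> exists psi : E -> 'F_2 * 'F_2,
      [/\ forall v, boundary (rho \o (toQ \o s)) (rho \o (toQ \o t)) psi v = 0,
        forall y, c y = 0 -> psi y != 0 & psi x != psi g]].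
  apply: (flow_avoiding conn3 char2B2 avoid3B2 (w := rho (toQ w))
    (w2 := rho (toQ w2)) uw uw2); by rewrite cutK.
have rE x : x \in [:: e; f; g; m; n] -> r x = x.
  by move=> xK; apply: rK; move: xK; rewrite !inE !orbA.
have flc u : u \in Q -> bd (c \o r) u = 0.
  by apply: (flowQ charF2); apply: (lift _ charF2); apply/(flowP _ _ charF2).
have split_hk : c (r h) = 0 \/ c (r k) = 0.
  have := flc _ w1Q; rewrite (bd_cut1 _ _ charF2) cw1 big_set3 //=.
  rewrite (rE f) ?inE ?eqxx ?orbT // => sum0.
  have [->|ch] := eqVneq (c (r h)) 0; [by left|right].
  by move: sum0; rewrite (F2_neq0 cf ch) add0r.
have rg x : x != g -> (forall X, X \subset Q -> cutV X <> [set x; g]) -> r x != g.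
  move=> xg nox; apply/eqP => rxg; have [|X] := r2 x.
    by rewrite rxg eq_sym.
  by have [Y YQ ->] := cutQ_sub X; rewrite rxg; apply: nox.
have main x : x != g -> (forall X, X \subset Q -> cutV X <> [set x; g]) ->
    c (r x) = 0 -> exists phi : E -> color,
    [/\ forall u, u \in Q -> bd phi u = 0, forall x, phi x != 0,
      phi x != phi e /\ phi x != phi g & phi m != phi e /\ phi m != phi f].
  move=> xg nox cx; have [psi [bdpsi nz psix]] := avoid _ cx (rg _ xg nox).
  exists (fun x => (c (r x), psi (r x))).
  have pairE (a b : color) : (a != b) = (a.1 != b.1) || (a.2 != b.2).
    by rewrite -pair_eqE /= /pair_eq negb_and.
  split=> [|y||].
  - exact: (flowQ char2B3 (lift _ char2B3 _ (flow_pair bdc bdpsi))).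
  - by rewrite pairE /=; case: eqVneq => //= /nz.
  - rewrite !pairE /= cx (rE e) ?(rE g) ?inE ?eqxx ?orbT // psix.
    by rewrite eq_sym ce orbT.
  - rewrite !pairE /= (rE m) ?(rE e) ?(rE f) ?inE ?eqxx ?orbT // cm.
    by rewrite !(eq_sym 0) ce cf.
have [ch|ck] := split_hk; first exact: main nohg ch.
(* Adding [phi f] exchanges [phi h] with [phi k] and [phi e] with [phi g], so the two inequalities
   for [k] yield those for [h]. *)
have [phi [bdphi nz [phike phikg] phim]] := main k kg nokg ck.
exists phi; split=> //.
have := bdphi _ w1Q; rewrite (bd_cut1 _ _ char2B3) cw1 big_set3 // => /eqP.
have := bdphi _ wQ; rewrite (bd_cut1 _ _ char2B3) cw big_set3 // => /eqP.
rewrite !(addr_eq0_char2 char2B3) => /eqP efg /eqP fhk.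
split.
  by apply: contra_neq phikg => phih; rewrite -fhk phih addrC.
apply: contra_neq phike => phih.
by rewrite -fhk phih -efg addrCA char2B3 addr0.
Qed.

End Quotient.

(** * Colors *)

Section Color.
Local Open Scope ring_scope.
Implicit Types (a b f g h m x : color) (S T : {set color}).

Definition dot (v x : color) : 'F_2 :=
  v.1 * x.1 + (v.2.1 * x.2.1 + v.2.2 * x.2.2).

Lemma dotD v x y : dot v (x + y) = dot v x + dot v y.
Proof.
case: x y => [x1 [x2 x3]] [y1 [y2 y3]]; rewrite /dot /= !mulrDr.
by rewrite [in RHS]addrACA [X in _ + X = _]addrACA.
Qed.

Definition colors : seq color :=
  let F2 : seq 'F_2 := [:: 0; 1] in
  [seq (i, jk) | i <- F2, jk <- [seq (j, k) | j <- F2, k <- F2]].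

Lemma mem_colors x : x \in colors.
Proof.
have F2 (i : 'F_2) : i = 0 \/ i = 1.
  by case: i => [[|[|i]] ?] //; [left|right]; apply: val_inj.
by case: x => i [j k]; case: (F2 i) => ->; case: (F2 j) => ->; case: (F2 k) => ->.
Qed.

(* A transvection of F2^3 fixing [a] and moving the line through [a] and [b]. *)
Lemma shear a b : a != 0 -> b != 0 -> a != b -> exists tau : color -> color,
  [/\ {morph tau : x y / x + y}, forall x, tau x = 0 -> x = 0, tau a = a,
    tau b != b & tau b != a + b].
Proof.
(* [v] is a linear form vanishing at [a] but not at [b], and [u] a vector of its kernel other than 0
   and [a]; the transvection adds [u] wherever the form is nonzero. Such a pair is found by
   enumeration. *)
pose ok (v u : color) := [&& dot v a == 0, dot v b != 0, dot v u == 0, u != 0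
  & u != a].
have : (a != 0) && (b != 0) && (a != b) ==> has (fun v => has (ok v) colors) colors.
  have /allP/(_ a (mem_colors a))/allP/(_ b (mem_colors b)) :
    all (fun a => all (fun b => (a != 0) && (b != 0) && (a != b) ==>
      has (fun v => has (fun u => [&& dot v a == 0, dot v b != 0, dot v u == 0,
        u != 0 & u != a]) colors) colors) colors) colors by vm_compute.
  by [].
move=> /implyP H a0 b0 ab; move: H; rewrite a0 b0 ab => /(_ isT).
case/hasP=> v _ /hasP[u _ /and5P[/eqP va vb /eqP vu u0 ua]].
exists (fun x => x + (if dot v x == 0 then 0 else u)); split.
- move=> x y; rewrite dotD [RHS]addrACA; congr (_ + _).
  have [->|vx] := eqVneq (dot v x) 0; first by rewrite !add0r.
  have [->|vy] := eqVneq (dot v y) 0; first by rewrite !addr0 (negPf vx).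
  by rewrite F2_neq0 // eqxx char2B3.
- move=> x; case: eqVneq => [_|vx]; first by rewrite addr0.
  move/eqP; rewrite (addr_eq0_char2 char2B3) => /eqP xu.
  by rewrite xu vu eqxx in vx.
- by rewrite va eqxx addr0.
- by rewrite (negPf vb) -[X in _ != X]addr0 (inj_eq (addrI _)).
- by rewrite (negPf vb) addrC (inj_eq (addIr _)).
Qed.

Definition nrm S T := (#|S :|: T| == 3%N) || (#|S :|: T| == 5%N).

Lemma nrmC S T : nrm S T = nrm T S.
Proof. by rewrite /nrm setUC. Qed.

Lemma nrm_imset (p : color -> color) S T : injective p ->
  nrm (p @: S) (p @: T) = nrm S T.
Proof. by move=> pI; rewrite /nrm -imsetU card_imset. Qed.

Lemma card_set_seq (r : seq color) : uniq r -> #|[set x in r]| = size r.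
Proof. by move=> ur; rewrite cardsE; apply/card_uniqP. Qed.

Lemma nrm_refl a b x : uniq [:: x; a; b] -> nrm [set x; a; b] [set x; a; b].
Proof.
move=> u3; rewrite /nrm setUid; apply/orP; left.
rewrite -[3%N]/(size [:: x; a; b]) -(card_set_seq u3).
by apply/eqP; apply: eq_card => y; rewrite !inE !orbA.
Qed.

Lemma nrm_rich a b c d x : uniq [:: x; a; b; c; d] ->
  nrm [set x; a; b] [set x; c; d].
Proof.
move=> u5; rewrite /nrm; apply/orP; right.
rewrite -[5%N]/(size [:: x; a; b; c; d]) -(card_set_seq u5).
apply/eqP; apply: eq_card => y; rewrite !inE.
by case: (y == x); case: (y == a); case: (y == b).
Qed.

Definition line S := exists a b, uniq [:: 0; a; b] /\ S = [set a; b; a + b].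

Lemma line_through S x : line S -> x \in S ->
  exists b, uniq [:: 0; x; b] /\ S = [set x; b; x + b].
Proof.
case=> a [b [u3 ->]]; move: u3; rewrite /= !inE !negb_or !andbT.
case/andP=> /andP[a0 b0] ab.
have ab0 : 0 != a + b by rewrite eq_sym (addr_eq0_char2 char2B3).
case/orP=> [/orP[]|] /eqP ->.
- by exists b; rewrite /= !inE !negb_or a0 b0 ab.
- exists a; rewrite /= !inE !negb_or a0 b0 eq_sym ab; split=> //.
  by rewrite (addrC b) [[set b; a]]setUC.
- exists b; rewrite /= !inE !negb_or b0 ab0 /= andbT; split.
    by rewrite -subr_eq0 addrK eq_sym.
  by rewrite (addrK_char2 char2B3) setUC setUA [[set a + b; a]]setUC
    -setUA [[set a + b; b]]setUC setUC -setUA setUC.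
Qed.

Lemma line_nrm S T x : line S -> line T -> x \in S -> x \in T -> nrm S T.
Proof.
move=> lS lT /(line_through lS)[b [ub ->]] /(line_through lT)[d [ud ->]].
move: ub ud; rewrite /= !inE !negb_or !andbT.
case/andP=> /andP[x0 b0] xb /andP[/andP[_ d0] xd].
have u3 y : 0 != y -> x != y -> uniq [:: x; y; x + y].
  move=> y0 xy; rewrite /= !inE !negb_or xy andbT /=.
  rewrite -{1}[x]addr0 (inj_eq (addrI _)) y0 /= -{1}[y]add0r.
  by rewrite (inj_eq (addIr _)).
have [->|bd] := eqVneq b d; first exact/nrm_refl/u3.
have [bxd|bxd] := eqVneq b (x + d).
  rewrite bxd (addKr_char2 char2B3).
  rewrite (_ : [set x; x + d; d] = [set x; d; x + d]); last first.
    by rewrite -!setUA [[set x + d; d]]setUC.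
  exact/nrm_refl/u3.
apply: nrm_rich; move: (u3 b b0 xb) (u3 d d0 xd); rewrite /= !inE !negb_or !andbT.
case/andP=> /andP[_ ->] -> /andP[/andP[_ ->] ->]; rewrite xb xd bd bxd /= !andbT.
rewrite (inj_eq (addrI _)) bd andbT; apply: contra bxd => /eqP <-.
by rewrite (addKr_char2 char2B3).
Qed.

(** The last pair is repaired by composing with the transposition of its actual and desired images,
    which moves no image already placed. *)
Lemma perm_seq_ext (T : finType) (r1 r2 : seq T) : uniq r1 -> uniq r2 ->
  size r1 = size r2 -> exists p : {perm T}, map p r1 = r2.
Proof.
elim/last_ind: r1 r2 => [|r1 x IH] r2; first by case: r2 => //; exists 1%g.
case/lastP: r2 => [|r2 y]; first by rewrite size_rcons.
rewrite !rcons_uniq !size_rcons => /andP[xr1 u1] /andP[yr2 u2] [sz].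
have [p pr] := IH r2 u1 u2 sz.
exists (p * tperm (p x) y)%g; rewrite map_rcons permM tpermL; congr rcons.
rewrite -pr; apply/eq_in_map => z zr1; rewrite permM tpermD //.
  by apply: contraNneq xr1 => /perm_inj ->.
by apply: contraNneq yr2 => ->; rewrite -pr map_f.
Qed.

(** The complement of the plane spanned by [f] and [g] is an affine plane with four points, in which
    a coset of {0, f} and a coset of {0, g} meet in one point. For the recoloring these cosets are
    what the lines at the far ends of two edges contain besides [f] and [g]. *)
Lemma coset_line f g h m : uniq [:: 0; f; g] ->
  h \notin [:: 0; f; g; f + g] -> m \notin [:: 0; f; g; f + g] ->
  exists b, [/\ b \in [:: h; f + h], b \in [:: m; g + m] &
    b \notin [:: 0; f; g; f + g]].
Proof.
move=> u3 hL mL.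
have /allP/(_ f (mem_colors f))/allP/(_ g (mem_colors g))/allP
  /(_ h (mem_colors h))/allP/(_ m (mem_colors m)) :
  all (fun f => all (fun g => all (fun h => all (fun m =>
    [&& uniq [:: 0; f; g], h \notin [:: 0; f; g; f + g]
      & m \notin [:: 0; f; g; f + g]] ==>
    has (fun b => [&& b \in [:: h; f + h], b \in [:: m; g + m]
      & b \notin [:: 0; f; g; f + g]]) colors) colors) colors) colors) colors.
  by vm_compute.
by rewrite u3 hL mL => /hasP[b _ /and3P[? ? ?]]; exists b.
Qed.

End Color.

(** * Components with one pendant edge *)

Section Coloring.
Local Open Scope ring_scope.
Variables (V E : finType) (s t : E -> V).
Implicit Types (X Y Q B : {set V}) (u v w : V) (x y z : E) (c phi : E -> color).

Local Notation bd := (boundary s t).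
Local Notation cut := (cut s t).
Local Notation inner := (inner s t).

Hypothesis loopless : forall x, s x != t x.
Hypothesis simple : forall u v x y, u != v -> x \in cut [set u] ->
  x \in cut [set v] -> y \in cut [set u] -> y \in cut [set v] -> x = y.

Lemma endsE x u : (x \in cut [set u]) = (s x == u) || (t x == u).
Proof.
rewrite in_cut1; have := loopless x; case: (eqVneq (s x) u) => [->|] //=.
by rewrite eq_sym => ->.
Qed.

Lemma ends3 x u v w : x \in cut [set u] -> x \in cut [set v] ->
  x \in cut [set w] -> u != v -> (w == u) || (w == v).
Proof.
rewrite !endsE => /orP[]/eqP <- /orP[]/eqP <- /orP[]/eqP <-;
  by rewrite ?eqxx ?orbT.
Qed.

Lemma cut_end x X : x \in cut X -> exists2 u, u \in X & x \in cut [set u].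
Proof.
rewrite inE; case sX: (s x \in X) => tX.
  by exists (s x) => //; rewrite endsE eqxx.
by exists (t x); rewrite ?endsE ?eqxx ?orbT //; case: (t x \in X) tX.
Qed.

Lemma cut_end_uniq x X u v : x \in cut X -> u \in X -> v \in X ->
  x \in cut [set u] -> x \in cut [set v] -> u = v.
Proof.
rewrite inE !endsE => + uX vX /orP[]/eqP ux /orP[]/eqP vx;
  by rewrite ?ux ?vx ?uX ?vX // -ux -vx.
Qed.

Lemma other_end x X u : u \in X -> x \in cut [set u] -> x \notin cut X ->
  exists v, [/\ v \in X, v != u & x \in cut [set v]].
Proof.
rewrite [x \in cut X]inE negbK endsE => uX xu /eqP stX.
have ux v : v = s x \/ v = t x -> x \in cut [set v].
  by case=> ->; rewrite endsE eqxx ?orbT.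
case/orP: xu => /eqP xu.
  by exists (t x); split; [rewrite -stX xu|rewrite eq_sym -xu|apply: ux; right].
by exists (s x); split; [rewrite stX xu|rewrite -xu|apply: ux; left].
Qed.

Lemma cut_out x X u v : u \in X -> v \notin X -> x \in cut [set u] ->
  x \in cut [set v] -> x \in cut X.
Proof.
move=> uX vX xu xv; apply: contraT => /(other_end uX xu)[w [wX wu xw]].
have : u != v by apply: contraNneq vX => <-.
case/(ends3 xu xv xw)/orP => /eqP wE; first by rewrite wE eqxx in wu.
by rewrite wE (negPf vX) in wX.
Qed.

Lemma cutD Q X x : X \subset Q ->
  (x \in cut (Q :\: X)) = (x \in cut Q) (+) (x \in cut X).
Proof.
move=> /subsetP XQ; rewrite !inE.
have QX u : u \in Q = false -> u \in X = false.
  by move=> uQ; apply: contraFF uQ; apply: XQ.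
case sQ: (s x \in Q); case tQ: (t x \in Q);
  rewrite ?(QX _ sQ) ?(QX _ tQ) ?andbF ?andbT //;
  by case: (s x \in X); case: (t x \in X).
Qed.

Lemma cubic_split u x : #|cut [set u]| = 3%N -> x \in cut [set u] ->
  exists y z, uniq [:: x; y; z] /\ cut [set u] = [set x; y; z].
Proof.
move=> c3 xu; move: c3; rewrite (cardsD1 x) xu => -[] /eqP/cards2P[y [z [yz yzE]]].
have [yD zD] : y \in cut [set u] :\ x /\ z \in cut [set u] :\ x.
  by rewrite yzE !inE !eqxx orbT.
exists y, z; split.
  move: yD zD; rewrite !in_setD1 uniq3E yz => /andP[yx _] /andP[zx _].
  by rewrite !(eq_sym x) yx zx.
by rewrite -setUA -yzE setD1K.
Qed.

Lemma cut_flow3 phi u x y z : bd phi u = 0 -> uniq [:: x; y; z] ->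
  cut [set u] = [set x; y; z] -> phi x + phi y = phi z.
Proof.
rewrite (bd_cut1 _ _ char2B3) => + u3 cu; rewrite cu big_set3 // => /eqP.
by rewrite (addr_eq0_char2 char2B3) => /eqP.
Qed.

Lemma flow_uniq phi u x y z : bd phi u = 0 -> (forall x, phi x != 0) ->
  uniq [:: x; y; z] -> cut [set u] = [set x; y; z] ->
  uniq [:: 0; phi x; phi y; phi z].
Proof.
move=> bdu nz u3 cu; have xyz := cut_flow3 bdu u3 cu.
have xy : phi x != phi y.
  by rewrite -(addr_eq0_char2 char2B3) xyz.
by rewrite -xyz; apply: (uniq_line char2B3); rewrite ?nz.
Qed.

Lemma flow_line phi u : bd phi u = 0 -> (forall x, phi x != 0) ->
  #|cut [set u]| = 3%N ->
  line (phi @: cut [set u]) /\ {in cut [set u] &, injective phi}.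
Proof.
move=> bdu nz c3; have [x xu] : exists x, x \in cut [set u].
  by apply/set0Pn; rewrite -card_gt0 c3.
have [y [z [u3 cu]]] := cubic_split c3 xu.
have u4 := flow_uniq bdu nz u3 cu; have xyz := cut_flow3 bdu u3 cu.
split.
  exists (phi x), (phi y); rewrite cu imset_set3 xyz; split=> //.
  exact: uniq4W u4.
by rewrite cu; apply: inj_set3; case/andP: u4.
Qed.

Lemma flow_cut2 phi B x y : (forall u, u \in B -> bd phi u = 0) ->
  cut B = [set x; y] -> x != y -> phi x = phi y.
Proof.
move=> bdB cB xy; apply/eqP; rewrite -(addr_eq0_char2 char2B3).
rewrite -(big_set1 +%R y phi) -big_setU1 ?inE // -cB -sum_bd_cut2 ?big1 //.
exact: char2B3.
Qed.

(* A linear automorphism of the colors fixing [phi f] may be applied inside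
   [B] when [B] is attached by [f] and one further edge only. *)
Lemma twist Q B f y h (p : color) phi :
  (forall u, u \in Q -> bd phi u = 0) -> (forall x, phi x != 0) ->
  B \subset Q -> cut B = [set f; y] -> f != y ->
  h \in inner B -> phi h != phi f ->
  exists phi', [/\ forall u, u \in Q -> bd phi' u = 0, forall x, phi' x != 0,
    forall x, x \notin inner B -> phi' x = phi x &
    phi' h != p /\ phi' h != phi f + p].
Proof.
move=> bdphi nz BQ cB fy hB hf.
have bdB u : u \in B -> bd phi u = 0 by move=> uB; apply: bdphi; apply: (subsetP BQ).
have [ok|] := boolP ((phi h != p) && (phi h != phi f + p)).
  by case/andP: ok => h1 h2; exists phi.
rewrite negb_and !negbK => hp; rewrite eq_sym in hf.
have [tau [tauD tau0 tauf tauh tauh']] := shear (nz f) (nz h) hf.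
exists (fun x => if x \in inner B then tau (phi x) else phi x).
(* Both edges of the cut carry [phi f], which [tau] fixes, so conservation survives at their ends in
   [B]. *)
have fB : phi y = phi f by rewrite (flow_cut2 bdB cB fy).
split.
- move=> u uQ; rewrite -[RHS](bdphi u uQ) !(bd_cut1 _ _ char2B3).
  have [uB|uB] := boolP (u \in B).
    have tau00 : tau 0 = 0.
      by apply/eqP; have := tauD 0 0; rewrite addr0 => /esym/eqP;
        rewrite -subr_eq0 addrK.
    transitivity (tau (\sum_(x in cut [set u]) phi x)).
      rewrite (big_morph tau tauD tau00); apply: eq_bigr => x xu.
      case: ifP => // xB; have : x \in cut B.
        move: xB xu uB; rewrite endsE !inE => xB /orP[]/eqP <-;
          by move: xB; case: (s x \in B); case: (t x \in B).
      by rewrite cB !inE => /orP[]/eqP ->; rewrite ?fB tauf.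
    by rewrite -(bd_cut1 _ _ char2B3) bdphi.
  apply: eq_bigr => x xu; rewrite ifN //; apply: contra uB.
  by move: xu; rewrite endsE !inE => /orP[]/eqP <- /andP[].
- by move=> x; case: ifP => // _; apply: contra_neq (nz x); apply: tau0.
- by move=> x /negPf ->.
rewrite hB; case/orP: hp => /eqP hp; first by rewrite -hp.
have pE : p = phi f + phi h by rewrite hp (addKr_char2 char2B3).
by rewrite pE (addKr_char2 char2B3).
Qed.

Definition good_on Q c := [/\ forall x, c x != 0,
  forall u, u \in Q -> {in cut [set u] &, injective c} &
  forall u v x, u \in Q -> v \in Q -> u != v ->
    x \in cut [set u] -> x \in cut [set v] ->
    nrm (c @: cut [set u]) (c @: cut [set v])].

(* [c] extends to [Q] together with one vertex joined to [e], [e'] and a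
   pendant edge of color [d]. *)
Definition pendant_col Q x y := exists c d, [/\ good_on Q c,
  uniq [:: 0; c x; c y; d] &
  forall u, u \in Q -> (x \in cut [set u]) || (y \in cut [set u]) ->
    nrm (c @: cut [set u]) [set c x; c y; d]].

(* The triangle formed by [e], [e'] and [f] with the extra vertex is contracted:
   expanding it again, each of its edges takes the color of the edge opposite. *)
Lemma adj_case Q e e' w w' f g k :
  w \in Q -> w' \in Q -> cut [set w] = [set e; f; g] ->
  cut [set w'] = [set e'; f; k] -> uniq [:: e; e'; f; g; k] ->
  cut Q = [set e; e'] -> w != w' ->
  pendant_col (Q :\ w :\ w') g k -> pendant_col Q e e'.
Proof.
move=> wQ w'Q cw cw' u5 cQ ww' [c [d [[nz inj nm] u4 ends]]].
move: (u5); rewrite uniq5E; case/and5P=> ee' ef eg ek.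
case/and5P=> e'f e'g e'k fg /andP[fk gk].
have [uw3 uw3'] : uniq [:: e; f; g] /\ uniq [:: e'; f; k].
  by rewrite !uniq3E ef eg fg e'f e'k fk.
set Q' := Q :\ w :\ w' in inj nm ends.
pose c1 x := if x == f then d else if x == e then c k else
  if x == e' then c g else c x.
have c1f : c1 f = d by rewrite /c1 eqxx.
have c1e : c1 e = c k by rewrite /c1 (negPf ef) eqxx.
have c1e' : c1 e' = c g by rewrite /c1 (negPf e'f) eq_sym (negPf ee') eqxx.
have c1g : c1 g = c g.
  by rewrite /c1 !(eq_sym g) (negPf fg) (negPf eg) (negPf e'g).
have c1k : c1 k = c k.
  by rewrite /c1 !(eq_sym k) (negPf fk) (negPf ek) (negPf e'k).
have [ew fw gw] : [/\ e \in cut [set w], f \in cut [set w] & g \in cut [set w]].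
  by rewrite cw !inE !eqxx !orbT.
have [ew' fw' kw'] : [/\ e' \in cut [set w'], f \in cut [set w'] & k \in cut [set w']].
  by rewrite cw' !inE !eqxx !orbT.
have [eQ e'Q] : e \in cut Q /\ e' \in cut Q by rewrite cQ !inE !eqxx orbT.
have QP u : (u \in Q') = [&& u != w, u != w' & u \in Q].
  by rewrite !inE andbCA.
have notin u : u \in Q' -> [/\ e \notin cut [set u], e' \notin cut [set u] &
    f \notin cut [set u]].
  rewrite QP => /and3P[uw uw' uQ]; split; apply/negP => xu.
  - by rewrite (cut_end_uniq eQ uQ wQ xu ew) eqxx in uw.
  - by rewrite (cut_end_uniq e'Q uQ w'Q xu ew') eqxx in uw'.
  - by have := ends3 fw fw' xu ww'; rewrite (negPf uw) (negPf uw').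
have c1Q u : u \in Q' -> {in cut [set u], c1 =1 c}.
  case/notin=> eu e'u fu x xu; rewrite /c1 !ifN //;
    by apply: contraTneq xu => ->.
have S1 u : u \in Q' -> c1 @: cut [set u] = c @: cut [set u].
  by move=> uQ; apply: eq_in_imset; apply: c1Q.
(* All three vertices of the expanded triangle see the set [T], so its edges are poor, and an edge
   leaving it behaves as it did at the contracted vertex. *)
pose T := [set c g; c k; d].
have Sw : c1 @: cut [set w] = T.
  by rewrite cw imset_set3 c1e c1f c1g; apply/setP=> a; rewrite !inE;
    case: (a == c k); case: (a == d); case: (a == c g).
have Sw' : c1 @: cut [set w'] = T.
  by rewrite cw' imset_set3 c1e' c1f c1k; apply/setP=> a; rewrite !inE;
    case: (a == c k); case: (a == d); case: (a == c g).
have [gk' gd kd] : [/\ c g != c k, c g != d & c k != d].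
  by move: u4; rewrite uniq4E => /and5P[_ _ _ -> /andP[-> ->]].
have nTT : nrm T T.
  by apply: nrm_refl; rewrite uniq3E gk' gd kd.
have wP u : u \in Q -> [|| u == w, u == w' | u \in Q'].
  by rewrite QP => ->; rewrite andbT; case: (u == w); case: (u == w').
have mixed u v x : v \in Q' -> x \in cut [set u] -> x \in cut [set v] ->
    (u == w) || (u == w') -> nrm T (c1 @: cut [set v]).
  move=> vQ xu xv uw; have [ev e'v fv] := notin v vQ.
  rewrite S1 // nrmC; apply: ends => //.
  have : x \in [:: e; e'; f; g; k].
    by case/orP: uw xu => /eqP ->; rewrite ?cw ?cw' !inE => /orP[/orP[]|] ->;
      rewrite ?orbT.
  rewrite !in_cons in_nil orbF.
  case/or4P => [/eqP xE|/eqP xE|/eqP xE|/orP[]/eqP xE];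
    by move: xv ev e'v fv; rewrite xE => ->; rewrite ?orbT.
exists c1, d; split; last 1 first.
- rewrite c1e c1e' => u uQ; have -> : [set c k; c g; d] = T.
    by rewrite /T [[set c k; _]]setUC.
  case/orP: (wP u uQ) => [/eqP ->|]; first by rewrite Sw.
  case/orP => [/eqP ->|uQ']; first by rewrite Sw'.
  by have [/negPf -> /negPf -> _] := notin u uQ'.
- split.
  + move=> x; have d0 : d != 0.
      by move: u4; rewrite uniq4E => /and3P[_ _ /andP[d0 _]]; rewrite eq_sym.
    by rewrite /c1; do 3!case: ifP => // _.
  + move=> u uQ; case/or3P: (wP u uQ) => [/eqP ->|/eqP ->|uQ'].
    * by rewrite cw; apply: inj_set3; rewrite c1e c1f c1g uniq3E kd
        !(eq_sym _ (c g)) gk' gd.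
    * by rewrite cw'; apply: inj_set3; rewrite c1e' c1f c1k uniq3E gd gk'
        (eq_sym d) kd.
    * move=> x y xu yu; rewrite !(c1Q u) //; exact: (inj u uQ').
  + move=> u v x uQ vQ uv xu xv.
    have [uw|uQ'] : (u == w) || (u == w') \/ u \in Q'.
      by case/or3P: (wP u uQ) => ->; rewrite ?orbT; auto.
      have [vw|vQ'] : (v == w) || (v == w') \/ v \in Q'.
        by case/or3P: (wP v vQ) => ->; rewrite ?orbT; auto.
      by case/orP: uw => /eqP ->; case/orP: vw => /eqP ->; rewrite ?Sw ?Sw'.
    have -> : c1 @: cut [set u] = T by case/orP: uw => /eqP ->.
    exact: mixed xu xv uw.
  have [vw|vQ'] : (v == w) || (v == w') \/ v \in Q'.
    by case/or3P: (wP v vQ) => ->; rewrite ?orbT; auto.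
    have -> : c1 @: cut [set v] = T by case/orP: vw => /eqP ->.
    rewrite nrmC; exact: mixed xv xu vw.
  by rewrite !S1 //; apply: nm xu xv.
- by rewrite c1e c1e'; apply: uniq4CA.
Qed.

(* Beyond the cut [{e, x0}] a flow suffices, once its colors are permuted to
   match the three colors at the extra vertex. *)
Lemma split_case Q Q1 e e' x0 :
  (forall u, u \in Q -> #|cut [set u]| = 3%N) ->
  (forall X, X \subset Q -> X != set0 -> (1 < #|cut X|)%N) ->
  Q1 \subset Q -> cut Q = [set e; e'] -> cut Q1 = [set e; x0] ->
  e != e' -> e != x0 -> e' != x0 -> pendant_col Q1 e x0 -> pendant_col Q e e'.
Proof.
move=> cubic cuts Q1Q cQ cQ1 ee' ex e'x [c [d [[nz inj nm] u4 ends]]].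
set Q2 := Q :\: Q1.
have cQ2 : cut Q2 = [set x0; e'].
  apply/setP=> x; rewrite cutD // cQ cQ1 !inE.
  have [->|xe] := eqVneq x e; first by rewrite (negPf ee') (negPf ex).
  have [->|_] := eqVneq x x0; first by rewrite /= (eq_sym x0) (negPf e'x).
  by rewrite /= addbF.
have Q2Q : Q2 \subset Q by apply: subsetDl.
have [phi [bdphi nzphi]] : exists phi : E -> color,
    (forall u, u \in Q2 -> bd phi u = 0) /\ forall x, phi x != 0.
  by apply: nz_flow => X XQ; apply: cuts; apply: subset_trans Q2Q.
have x0e' : x0 != e' by rewrite eq_sym.
have phix0 : phi x0 = phi e' by apply: flow_cut2 bdphi cQ2 x0e'.
have cub2 u : u \in Q2 -> #|cut [set u]| = 3%N.
  by move=> uQ; apply: cubic; apply: (subsetP Q2Q).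
have [u2 u2Q x0u2] : exists2 u, u \in Q2 & x0 \in cut [set u].
  by apply: cut_end; rewrite cQ2 !inE eqxx.
have [y1 [y2 [u3 cu2]]] := cubic_split (cub2 u2 u2Q) x0u2.
have uphi := flow_uniq (bdphi u2 u2Q) nzphi u3 cu2.
have u4' : uniq [:: 0; c x0; c e; d] by apply: uniq4CA.
(* Any permutation of the colors, linear or not, keeps edges poor or rich. This one gives [u2] the
   three colors of the extra vertex of [Q1]; [u2] thus takes over its role, and the extra vertex of
   [Q] receives the same three colors. *)
have [p [p0 px py1 py2]] := perm_seq_ext uphi u4' (erefl _).
pose inc x := (s x \in Q2) || (t x \in Q2).
pose c1 x := if inc x then p (phi x) else c x.
have incP u x : u \in Q2 -> x \in cut [set u] -> inc x.
  by rewrite endsE /inc => uQ /orP[]/eqP ->; rewrite uQ ?orbT.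
have incQ1 u x : u \in Q1 -> x \in cut [set u] -> inc x -> x = x0.
  move=> uQ1 xu xinc; have [v vQ2 xv] : exists2 v, v \in Q2 & x \in cut [set v].
    by case/orP: xinc => xQ; [exists (s x)|exists (t x)]; rewrite // endsE eqxx ?orbT.
  have vQ1 : v \notin Q1 by move: vQ2; rewrite inE => /andP[].
  have uQ2 : u \notin Q2 by rewrite inE uQ1.
  have := cut_out uQ1 vQ1 xu xv; rewrite cQ1 !inE => /orP[]/eqP // xe.
  have := cut_out vQ2 uQ2 xv xu; rewrite cQ2 xe !inE.
  by rewrite (negPf ex) (negPf ee').
have c1Q1 u : u \in Q1 -> {in cut [set u], c1 =1 c}.
  move=> uQ1 x xu; rewrite /c1; case: ifP => // /(incQ1 _ _ uQ1 xu) ->.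
  by rewrite px.
have c1Q2 u : u \in Q2 -> {in cut [set u], c1 =1 p \o phi}.
  by move=> uQ2 x xu; rewrite /c1 (incP u).
have S1 u : u \in Q1 -> c1 @: cut [set u] = c @: cut [set u].
  by move=> uQ; apply: eq_in_imset; apply: c1Q1.
have S2 u : u \in Q2 -> c1 @: cut [set u] = p @: (phi @: cut [set u]).
  by move=> uQ; rewrite -imset_comp; apply: eq_in_imset; apply: c1Q2.
have line2 u : u \in Q2 -> line (phi @: cut [set u]).
  by move=> uQ; have [] := flow_line (bdphi u uQ) nzphi (cub2 u uQ).
have nm2 u v x y : u \in Q2 -> v \in Q2 -> x \in cut [set u] ->
    y \in cut [set v] -> phi x = phi y ->
    nrm (c1 @: cut [set u]) (c1 @: cut [set v]).
  move=> uQ vQ xu yv xy; rewrite !S2 // nrm_imset; last exact: perm_inj.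
  apply: (line_nrm (line2 u uQ) (line2 v vQ) (x := phi x)).
    exact: imset_f.
  by rewrite xy; apply: imset_f.
have Su2 : c1 @: cut [set u2] = [set c e; c x0; d].
  by rewrite S2 // cu2 !imset_set3 px py1 py2 [[set c x0; c e]]setUC.
have c1e : c1 e = c e.
  have eQ1 : e \in cut Q1 by rewrite cQ1 !inE eqxx.
  have [w wQ1 ew] := cut_end eQ1; exact: c1Q1 ew.
have c1e' : c1 e' = c x0.
  have eQ2 : e' \in cut Q2 by rewrite cQ2 !inE eqxx orbT.
  have [w wQ2 ew] := cut_end eQ2; by rewrite (c1Q2 w wQ2 e' ew) /= -phix0 px.
have Q12 u : u \in Q -> u \in Q1 \/ u \in Q2.
  by move=> uQ; rewrite inE uQ andbT; case: (u \in Q1); auto.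
have mixed u v x : u \in Q1 -> v \in Q2 -> x \in cut [set u] ->
    x \in cut [set v] -> nrm (c1 @: cut [set u]) (c1 @: cut [set v]).
  move=> uQ1 vQ2 xu xv; have xE := incQ1 u x uQ1 xu (incP v x vQ2 xv).
  have x0v : x0 \in cut [set v] by rewrite -xE.
  have x0Q2 : x0 \in cut Q2 by rewrite cQ2 !inE eqxx.
  have <- := cut_end_uniq x0Q2 u2Q vQ2 x0u2 x0v.
  by rewrite Su2 S1 //; apply: ends; rewrite // -xE xu orbT.
exists c1, d; rewrite c1e c1e'; split=> //.
- split.
  + move=> x; rewrite /c1; case: ifP => // _.
    by rewrite -p0 (inj_eq perm_inj).
  + move=> u /Q12[] uQ.
      by move=> x y xu yu; rewrite !(c1Q1 u) //; apply: (inj u).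
    move=> x y xu yu; rewrite !(c1Q2 u) //= => /perm_inj.
    by have [_] := flow_line (bdphi u uQ) nzphi (cub2 u uQ); apply.
  + move=> u v x /Q12[] uQ /Q12[] vQ uv xu xv.
    * by rewrite !S1 //; apply: nm xu xv.
    * exact: mixed xu xv.
    * by rewrite nrmC; apply: mixed xv xu.
    * exact: nm2 xu xv _.
- move=> u uQ; case: (Q12 u uQ) => uQ' /orP[] xu.
  + by rewrite S1 //; apply: ends; rewrite ?xu.
  + have e'Q : e' \in cut Q by rewrite cQ !inE eqxx orbT.
    have : e' \in cut Q1.
      have [v vQ2 e'v] : exists2 v, v \in Q2 & e' \in cut [set v].
        by apply: cut_end; rewrite cQ2 !inE eqxx orbT.
      have vQ := subsetP Q2Q v vQ2.
      by move: vQ2; rewrite -(cut_end_uniq e'Q uQ vQ xu e'v) inE uQ'.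
    by rewrite cQ1 !inE eq_sym (negPf ee') (negPf e'x).
  + have [w wQ ew] : exists2 w, w \in Q1 & e \in cut [set w].
      by apply: cut_end; rewrite cQ1 !inE eqxx.
    by have /eqP := incQ1 w e wQ ew (incP u e uQ' xu); rewrite (negPf ex).
  + by rewrite -Su2; apply: nm2 xu x0u2 _.
Qed.

(** Only the star of [w] ceases to be a line. Writing edges for their colors, it meets the lines {f,
    b, f + b} and {g, b, g + b} at its neighbors and {e + b, e, b} at the extra vertex in one color
    each, so its three edges are rich. Every other edge still joins two lines; [e'] qualifies
    because it carries the flow value of [e]. *)
Lemma recolor_case Q e e' w w1 w2 f g h k m n phi :
  (forall u, u \in Q -> #|cut [set u]| = 3%N) ->
  (forall u, u \in Q -> bd phi u = 0) -> (forall x, phi x != 0) ->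
  cut Q = [set e; e'] -> e != e' ->
  w \in Q -> w1 \in Q -> w2 \in Q -> w1 != w -> w2 != w ->
  uniq [:: e; f; g] -> uniq [:: f; h; k] -> uniq [:: g; m; n] ->
  cut [set w] = [set e; f; g] -> cut [set w1] = [set f; h; k] ->
  cut [set w2] = [set g; m; n] ->
  phi h != phi e -> phi h != phi g -> phi m != phi e -> phi m != phi f ->
  pendant_col Q e e'.
Proof.
move=> cubic bdphi nz cQ ee' wQ w1Q w2Q w1w w2w u3 u31 u32 cw cw1 cw2 he hg me mf.
have ew : e \in cut [set w] by rewrite cw !inE eqxx.
have [eQ e'Q] : e \in cut Q /\ e' \in cut Q by rewrite cQ !inE !eqxx orbT.
have u4 := flow_uniq (bdphi w wQ) nz u3 cw.
have u41 := flow_uniq (bdphi w1 w1Q) nz u31 cw1.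
have u42 := flow_uniq (bdphi w2 w2Q) nz u32 cw2.
have efg := cut_flow3 (bdphi w wQ) u3 cw.
have fhk := cut_flow3 (bdphi w1 w1Q) u31 cw1.
have gmn := cut_flow3 (bdphi w2 w2Q) u32 cw2.
have phiee' : phi e = phi e' by apply: flow_cut2 bdphi cQ ee'.
have efg' : phi f + phi g = phi e by rewrite -efg addrC (addrK_char2 char2B3).
move: u4 u41 u42; rewrite !uniq4E !(eq_sym 0).
case/and5P=> e0 f0 g0 ef /andP[eg fg] /and5P[_ h0 k0 fh /andP[fk hk]].
case/and5P=> _ m0 n0 gm /andP[gn mn].
have [b [bh bm bL]] : exists b, [/\ b \in [:: phi h; phi f + phi h],
    b \in [:: phi m; phi g + phi m] &
    b \notin [:: 0; phi f; phi g; phi f + phi g]].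
  apply: coset_line; [|rewrite efg' !inE !negb_or..].
  - by rewrite uniq3E !(eq_sym 0) f0 g0 fg.
  - by rewrite h0 hg he eq_sym fh.
  - by rewrite m0 mf me eq_sym gm.
have u03 : uniq [:: 0; phi f; phi g] by rewrite uniq3E !(eq_sym 0) f0 g0 fg.
rewrite efg' in bL; have [u5f u5g u5e] := recolor_uniq char2B3 (esym efg') u03 bL.
have /and4P[b0 _ _ be] : [&& b != 0, b != phi f, b != phi g & b != phi e].
  by move: bL; rewrite !inE !negb_or.
have /and4P[ebf ebg ebe fg'] : [&& phi e + b != phi f, phi e + b != phi g,
    phi e + b != phi e & phi f != phi g].
  by move: u5e; rewrite uniq5E => /and5P[-> -> -> _ /andP[->]].
have eb0 : phi e + b != 0 by rewrite (addr_eq0_char2 char2B3) eq_sym.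
have u0eb : uniq [:: 0; phi e + b; phi e; b].
  by have := uniq_line char2B3 eb0 e0 ebe; rewrite addrAC char2B3 add0r.
pose c x := if x == e then phi e + b else phi x.
have ce : c e = phi e + b by rewrite /c eqxx.
have ce' : c e' = phi e by rewrite /c eq_sym (negPf ee') phiee'.
have cw_notin u x : u \in Q -> u != w -> x \in cut [set u] -> x != e.
  move=> uQ uw xu; apply: contraNneq uw => xe; apply/eqP.
  by apply: (cut_end_uniq eQ) => //; rewrite -xe.
have cphi u : u \in Q -> u != w -> {in cut [set u], c =1 phi}.
  by move=> uQ uw x xu; rewrite /c ifN // (cw_notin u).
have Sphi u : u \in Q -> u != w -> c @: cut [set u] = phi @: cut [set u].
  by move=> uQ uw; apply: eq_in_imset; apply: cphi.
have fl u : u \in Q -> line (phi @: cut [set u]) /\ {in cut [set u] &, injective phi}.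
  by move=> uQ; apply: flow_line (bdphi u uQ) nz (cubic u uQ).
have [ef' eg'] : e != f /\ e != g.
  by move: u3; rewrite /= !inE negb_or => /andP[/andP[]].
have Sw : c @: cut [set w] = [set phi e + b; phi f; phi g].
  by rewrite cw imset_set3 ce /c ![_ == e]eq_sym (negPf ef') (negPf eg').
have Lswap (x a : color) (y : color) : y \in [:: a; x + a] ->
    [set x; a; x + a] = [set x; y; x + y].
  rewrite !inE => /orP[]/eqP -> //; rewrite (addKr_char2 char2B3).
  by rewrite -!setUA [[set a; _]]setUC.
have S1 : c @: cut [set w1] = [set phi f; b; phi f + b].
  by rewrite Sphi // cw1 imset_set3 -fhk; apply: Lswap.
have S2 : c @: cut [set w2] = [set phi g; b; phi g + b].
  by rewrite Sphi // cw2 imset_set3 -gmn; apply: Lswap.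
have n1 : nrm (c @: cut [set w]) (c @: cut [set w1]).
  by rewrite Sw S1 [[set phi e + b; phi f]]setUC; apply: nrm_rich.
have n2 : nrm (c @: cut [set w]) (c @: cut [set w2]).
  rewrite Sw S2 (_ : [set _; _; phi g] = [set phi g; phi e + b; phi f]); last first.
    by rewrite setUC setUA.
  exact: nrm_rich.
have nT : nrm (c @: cut [set w]) [set c e; c e'; b].
  by rewrite Sw ce ce'; apply: nrm_rich.
have fw1 : f \in cut [set w1] by rewrite cw1 !inE eqxx.
have gw2 : g \in cut [set w2] by rewrite cw2 !inE eqxx.
have [fw gw] : f \in cut [set w] /\ g \in cut [set w].
  by rewrite cw !inE !eqxx !orbT.
have nw v x : v \in Q -> v != w -> x \in cut [set w] -> x \in cut [set v] ->
    nrm (c @: cut [set w]) (c @: cut [set v]).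
  move=> vQ vw xw xv; have wv : w != v by rewrite eq_sym.
  have : x \in [set e; f; g] by rewrite -cw.
  rewrite !inE => /orP[/orP[]|] /eqP xE.
  - by rewrite xE in xv; rewrite (cut_end_uniq eQ vQ wQ xv ew) eqxx in vw.
  - rewrite xE in xv; have := ends3 fw xv fw1 wv.
    by rewrite (negPf w1w) => /eqP <-.
  - rewrite xE in xv; have := ends3 gw xv gw2 wv.
    by rewrite (negPf w2w) => /eqP <-.
exists c, b; split.
- split.
  + by move=> x; rewrite /c; case: ifP.
  + move=> u uQ; have [->|uw] := eqVneq u w.
      rewrite cw; apply: inj_set3; rewrite ce /c ![_ == e]eq_sym (negPf ef')
        (negPf eg') uniq3E.
      by rewrite ebf ebg fg.
    by move=> x y xu yu; rewrite !(cphi u) //; apply: (fl u uQ).2.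
  + move=> u v x uQ vQ uv xu xv; have [uw|uw] := eqVneq u w.
      by rewrite uw in uv xu *; apply: nw xu xv; rewrite // eq_sym.
    have [vw|vw] := eqVneq v w.
      by rewrite vw in uv xv *; rewrite nrmC; apply: nw xv xu.
    rewrite !Sphi //; apply: (line_nrm (fl u uQ).1 (fl v vQ).1 (x := phi x));
      exact: imset_f.
- by rewrite ce ce'; apply: u0eb.
- move=> u uQ; have [-> _|uw] := eqVneq u w; first exact: nT.
  case/orP=> xu; first by rewrite (cut_end_uniq eQ uQ wQ xu ew) eqxx in uw.
  rewrite Sphi //; apply: (line_nrm (fl u uQ).1 _ (imset_f phi xu)).
    rewrite ce ce'; exists (phi e), b; split.
      by move: u0eb; rewrite uniq4E uniq3E => /and5P[_ -> -> _ /andP[_ ->]].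
    by rewrite -setUA setUC.
  by rewrite -phiee' -ce' !inE eqxx orbT.
Qed.

Lemma cubic_split2 u x y : #|cut [set u]| = 3%N -> x \in cut [set u] ->
  y \in cut [set u] -> x != y ->
  exists z, uniq [:: x; y; z] /\ cut [set u] = [set x; y; z].
Proof.
move=> c3 xu; have [a [b [u3 cu]]] := cubic_split c3 xu.
rewrite cu !inE => /orP[/orP[]|] /eqP -> xy; first by rewrite eqxx in xy.
  by exists b.
exists a; split; last by rewrite -!setUA [[set a; b]]setUC.
by move: u3; rewrite !uniq3E (eq_sym b) => /and3P[-> -> ->].
Qed.

Lemma symd_sub Q X u : X \subset Q -> u \in Q -> symd X [set u] \subset Q.
Proof.
move=> /subsetP XQ uQ; apply/subsetP=> v; rewrite !inE.
by case: eqVneq => [->|_] //; rewrite addbF => /XQ.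
Qed.

(** * Cubic vertex sets without small cuts *)

Section Bridgeless.
Variable Q : {set V}.
Hypothesis cubic : forall u, u \in Q -> #|cut [set u]| = 3%N.
Hypothesis cuts : forall X, X \subset Q -> X != set0 -> (1 < #|cut X|)%N.

Lemma no_cut1 X : X \subset Q -> #|cut X| <> 1%N.
Proof.
move=> XQ cX; have [X0|/(cuts XQ)] := eqVneq X set0; last by rewrite cX.
suff c0 : cut X = set0 by rewrite c0 cards0 in cX.
by apply/setP=> x; rewrite X0 !inE.
Qed.

(** Moving [u] across [X] would leave the third edge at [u] as the only edge of the cut. *)
Lemma cut2_star X u x y : X \subset Q -> u \in Q -> cut X = [set x; y] ->
  x != y -> x \in cut [set u] -> y \in cut [set u] -> False.
Proof.
move=> XQ uQ cX xy xu yu; apply: (no_cut1 (symd_sub XQ uQ)).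
have -> : cut (symd X [set u]) = cut [set u] :\: cut X.
  apply/setP=> z; rewrite cut_symd in_setD.
  case zX: (z \in cut X) => //=; move: zX; rewrite cX in_set2.
  by case/orP=> /eqP ->; rewrite ?xu ?yu.
have sub : cut X \subset cut [set u].
  by rewrite cX subUset !sub1set xu yu.
by rewrite cardsD (setIidPr sub) cubic // cX cards2 xy.
Qed.

(** [w1] is the end of [f] in [B], and [h] lies inside [B] since [f] and [h] cannot form a cut.
    Hence the line at [w1] can be turned away from the line at [w] without touching any edge at a
    vertex outside [B]. *)
Lemma twist_star w w1 e f g h k B y phi :
  w \in Q -> w1 \in Q -> w \notin B -> w1 != w ->
  uniq [:: e; f; g] -> uniq [:: f; h; k] ->
  cut [set w] = [set e; f; g] -> cut [set w1] = [set f; h; k] ->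
  B \subset Q -> cut B = [set f; y] -> f != y ->
  (forall u, u \in Q -> bd phi u = 0) -> (forall x, phi x != 0) ->
  exists phi', [/\ forall u, u \in Q -> bd phi' u = 0, forall x, phi' x != 0,
    forall v x, v \notin B -> x \in cut [set v] -> phi' x = phi x &
    phi' h != phi' e /\ phi' h != phi' g].
Proof.
move=> wQ w1Q wB w1w u3 u31 cw cw1 BQ cB fy bdphi nz.
have [ew fw gw] : [/\ e \in cut [set w], f \in cut [set w] & g \in cut [set w]].
  by rewrite cw !inE !eqxx !orbT.
have [fw1 hw1] : f \in cut [set w1] /\ h \in cut [set w1].
  by rewrite cw1 !inE !eqxx !orbT.
have w1B : w1 \in B.
  have fB : f \in cut B by rewrite cB !inE eqxx.
  have [v vB fv] := cut_end fB.
  have ww1 : w != w1 by rewrite eq_sym.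
  by case/orP: (ends3 fw fw1 fv ww1) => /eqP vE; rewrite vE ?(negPf wB) in vB.
have [fh _ _] : [/\ f != h, f != k & h != k] by apply/and3P; rewrite -uniq3E.
have hB : h \in inner B.
  have : h \notin cut B.
    rewrite cB !inE eq_sym (negPf fh) /=; apply/eqP => hy.
    by rewrite -hy in cB fy; apply: (cut2_star BQ w1Q cB fy fw1 hw1).
  move: hw1; rewrite endsE !inE => /orP[]/eqP hw1; rewrite hw1 w1B;
    by case: (_ \in B).
have phifh : phi h != phi f.
  have := flow_uniq (bdphi w1 w1Q) nz u31 cw1.
  by rewrite uniq4E => /and5P[_ _ _ fh' _]; rewrite eq_sym.
have [phi' [bdphi' nz' eq' [he hg]]] := twist (phi e) bdphi nz BQ cB fy hB phifh.
exists phi'; have out v x : v \notin B -> x \in cut [set v] -> phi' x = phi x.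
  move=> vB xv; apply: eq'; apply: contra vB; rewrite inE.
  by move: xv; rewrite endsE => /orP[]/eqP -> /andP[].
split=> //; rewrite (out w e wB ew) (out w g wB gw) he.
have := cut_flow3 (bdphi w wQ) u3 cw; rewrite addrC => <-.
by split.
Qed.

Section Star.
Variables (e e' : E) (w w' : V).
Hypotheses (cQ : cut Q = [set e; e']) (ee' : e != e') (ww' : w != w').
Hypotheses (wQ : w \in Q) (ew : e \in cut [set w]).
Hypotheses (w'Q : w' \in Q) (e'w' : e' \in cut [set w']).
Hypothesis nadj : forall x, x \in cut [set w] -> x \notin cut [set w'].
Hypothesis e_cut : forall X y, X \subset Q -> y != e -> cut X = [set e; y] -> y = e'.

Lemma eQ : e \in cut Q. Proof. by rewrite cQ !inE eqxx. Qed.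
Lemma e'Q : e' \in cut Q. Proof. by rewrite cQ !inE eqxx orbT. Qed.

Lemma e_out u : u \in Q -> u != w -> e \notin cut [set u].
Proof.
by move=> uQ uw; apply: contra uw => eu; rewrite (cut_end_uniq eQ uQ wQ eu ew).
Qed.

Lemma e'_out u : u \in Q -> u != w' -> e' \notin cut [set u].
Proof.
move=> uQ uw; apply: contra uw => eu.
by rewrite (cut_end_uniq e'Q uQ w'Q eu e'w').
Qed.

Lemma neighbor f : f \in cut [set w] -> f != e ->
  exists w1 h k, [/\ w1 \in Q, w1 != w, w1 != w', uniq [:: f; h; k] &
    cut [set w1] = [set f; h; k]].
Proof.
move=> fw fe; have [|w1 [w1Q w1w fw1]] := other_end wQ fw.
  rewrite cQ !inE negb_or fe /=; apply: contraTneq fw => ->.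
  exact: e'_out.
have [h [k [u3 cw1]]] := cubic_split (cubic w1Q) fw1.
exists w1, h, k; split=> //; apply: contraTneq fw1 => ->; exact: nadj.
Qed.

(** With [w] in [X], the edge [e], whose other end lies outside [Q], would cross the cut too, and
    its partner [f] would have to be [e']; but [e'] is not at [w]. *)
Lemma cut_not_w X f y : X \subset Q -> cut X = [set f; y] -> f != e ->
  f \in cut [set w] -> f != y -> w \notin X.
Proof.
move=> XQ cX fe fw fy; apply/negP => wX.
have : e \in cut X.
  apply: contraT => /(other_end wX ew)[v [vX vw ev]].
  by have := e_out (subsetP XQ v vX) vw; rewrite ev.
rewrite cX !inE eq_sym (negPf fe) => /eqP ey.
have fE : f = e' by apply: (e_cut XQ fe); rewrite cX -ey setUC.
by have := e'_out wQ ww'; rewrite -fE fw.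
Qed.

(** Here [rich_flow] applies. A cut of size two among the edges at [w] and [w2] avoids [e], whose
    only partner is [e'], and avoids [f] by assumption, so both its edges lie at [w2], against
    [cut2_star]. *)
Lemma rich_col w1 w2 f g h k m n : w1 \in Q -> w2 \in Q ->
  w1 != w -> w2 != w -> w1 != w' -> w2 != w' ->
  uniq [:: e; f; g] -> uniq [:: f; h; k] -> uniq [:: g; m; n] ->
  cut [set w] = [set e; f; g] -> cut [set w1] = [set f; h; k] ->
  cut [set w2] = [set g; m; n] ->
  (forall X y, X \subset Q -> f != y -> cut X <> [set f; y]) ->
  pendant_col Q e e'.
Proof.
move=> w1Q w2Q w1w w2w w1w' w2w' u3 u31 u32 cw cw1 cw2 trivf.
have [fw gw] : f \in cut [set w] /\ g \in cut [set w].
  by rewrite cw !inE !eqxx !orbT.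
have [fw1 [hw1 kw1]] : f \in cut [set w1] /\ h \in cut [set w1] /\ k \in cut [set w1].
  by rewrite cw1 !inE !eqxx !orbT.
have [gw2 [mw2 nw2]] : g \in cut [set w2] /\ m \in cut [set w2] /\ n \in cut [set w2].
  by rewrite cw2 !inE !eqxx !orbT.
have [ef eg fg] : [/\ e != f, e != g & f != g] by apply/and3P; rewrite -uniq3E.
have [gm gn mn] : [/\ g != m, g != n & m != n] by apply/and3P; rewrite -uniq3E.
have [fh fk hk] : [/\ f != h, f != k & h != k] by apply/and3P; rewrite -uniq3E.
have gw1 : g \notin cut [set w1].
  by apply: contraNN fg => gw1; rewrite (simple w1w fw1 fw gw1 gw).
have mw : m \notin cut [set w].
  by apply: contraNN gm => mw; rewrite (simple w2w gw2 gw mw2 mw).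
have hg : h != g by apply: contraNneq gw1 => <-.
have kg : k != g by apply: contraNneq gw1 => <-.
(* Moving [w] and [w1] across such a cut would turn it into [e] and [y], forcing [y] to be [e'],
   which is not at [w1]. *)
have nohg x y X : x != y -> x \in cut [set w1] -> cut [set w1] = [set f; x; y] ->
    x != g -> f != x -> y != e -> X \subset Q -> cut X <> [set x; g].
  move=> xy xw1 cw1' xg fx ye XQ cX.
  have yE : y = e'.
    apply: (@e_cut (symd (symd X [set w]) [set w1])) => //.
      by apply: symd_sub w1Q; apply: symd_sub wQ.
    have xe : x != e by apply: contraTneq xw1 => ->; apply: e_out.
    apply/setP=> z; rewrite !cut_symd cX cw cw1' !inE.
    have [->|zx] := eqVneq z x.
      by rewrite (negPf xg) (negPf xe) [x == f]eq_sym (negPf fx) (negPf xy).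
    have [->|zg] := eqVneq z g.
      by rewrite !orbT [g == e]eq_sym (negPf eg) [g == f]eq_sym (negPf fg).
    have [->|zf] := eqVneq z f.
      rewrite [f == e]eq_sym (negPf ef) /=; apply/esym/negbTE/negP => /eqP fy.
      have := cubic w1Q; rewrite cw1' -fy setUC setUA setUid cards2.
      by case: (_ != _).
    rewrite !orbF /=; case: (eqVneq z e) => [->|_] //=.
    by rewrite eq_sym (negPf ye).
  by have := e'_out w1Q w1w'; rewrite -yE cw1' !inE eqxx orbT.
have cw1' : cut [set w1] = [set f; k; h] by rewrite cw1 -!setUA [[set h; k]]setUC.
have ne x : x \in cut [set w1] -> x != e.
  by move=> xw1; apply: contraTneq xw1 => ->; apply: e_out.
have [|||phi [bdphi nz [he hg'] [me mf]]] := rich_flow cuts wQ w1Q w2Q u3 u31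
  u32 cw cw1 cw2 (e_out w2Q w2w) mw hg kg.
- move=> X x y XQ xK yK xy cX.
  have notin z : z \in [set e; f; g] :|: [set m; n] -> z != e'.
    rewrite -cw inE => /orP[] zK; apply: contraTneq zK => ->.
      exact: e'_out.
    have : [set m; n] \subset cut [set w2] by rewrite cw2 -setUA subsetUr.
    by move/subsetP=> sub; apply: contra (e'_out w2Q w2w') => /sub.
  have ex z (v : E) : cut X = [set z; v] -> z != v ->
      v \in [set e; f; g] :|: [set m; n] -> z != e /\ z != f.
    move=> cX' zv vK; split; apply/eqP => zE; rewrite zE in cX' zv.
      have ve : v != e by rewrite eq_sym.
      by have := notin v vK; rewrite (e_cut XQ ve cX') eqxx.
    exact: (trivf X v).
  have star z : z \in [set e; f; g] :|: [set m; n] -> z != e /\ z != f ->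
      z \in cut [set w2].
    move=> zK [/negPf ze /negPf zf]; move: zK.
    by rewrite cw2 !inE ze zf /= orbA.
  apply: (cut2_star XQ w2Q cX xy); apply: star => //; first exact: ex cX xy yK.
  by apply: (ex y x) => //; rewrite ?cX 1?setUC // eq_sym.
- by move=> X; apply: (nohg h k); rewrite ?ne.
- by move=> X; apply: (nohg k h); rewrite ?ne // eq_sym.
exact: (recolor_case cubic bdphi nz cQ ee' wQ w1Q w2Q w1w w2w u3 u31 u32 cw cw1 cw2).
Qed.

(** If [f] or [g] lies in no cut of size two, [rich_col] applies, up to exchanging the two.
    Otherwise any nowhere-zero flow on [Q] can be corrected at each neighbor of [w] by a twist
    beyond its own cut, and the second twist does not undo the first. *)
Lemma star_col : pendant_col Q e e'.
Proof.
have [f [g [u3 cw]]] := cubic_split (cubic wQ) ew.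
have [ef eg fg] : [/\ e != f, e != g & f != g] by apply/and3P; rewrite -uniq3E.
have [fe ge] : f != e /\ g != e by rewrite ![_ == e]eq_sym.
have [fw gw] : f \in cut [set w] /\ g \in cut [set w].
  by rewrite cw !inE !eqxx !orbT.
have [w1 [h [k [w1Q w1w w1w' u31 cw1]]]] := neighbor fw fe.
have [w2 [m [n [w2Q w2w w2w' u32 cw2]]]] := neighbor gw ge.
pose nontriv f := [exists X : {set V}, [exists y,
  [&& X \subset Q, f != y & cut X == [set f; y]]]].
have trivP x : ~~ nontriv x ->
    forall X y, X \subset Q -> x != y -> cut X <> [set x; y].
  move=> nx X y XQ xy /eqP cX; case/negP: nx; apply/existsP; exists X.
  by apply/existsP; exists y; rewrite XQ xy.
have [|trivf] := boolP (nontriv f); last first.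
  exact: (rich_col w1Q w2Q w1w w2w w1w' w2w' u3 u31 u32 cw cw1 cw2 (trivP f trivf)).
case/existsP=> B /existsP[y /and3P[BQ fy /eqP cB]].
have [|trivg] := boolP (nontriv g); last first.
  apply: (rich_col w2Q w1Q w2w w1w w2w' w1w' _ u32 u31 _ cw2 cw1 (trivP g trivg)).
    by rewrite uniq3E eg ef eq_sym.
  by rewrite cw -!setUA [[set f; g]]setUC.
case/existsP=> B' /existsP[y' /and3P[B'Q gy' /eqP cB']].
have wB := cut_not_w BQ cB fe fw fy.
have wB' := cut_not_w B'Q cB' ge gw gy'.
(* Otherwise [f] would cross the cut of [B'] and form it together with [g], although both are at
   [w]. *)
have w1B' : w1 \notin B'.
  apply/negP => w1B'; have fw1 : f \in cut [set w1] by rewrite cw1 !inE eqxx.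
  have := cut_out w1B' wB' fw1 fw; rewrite cB' !inE (negPf fg) => /eqP fy'.
  by rewrite -fy' in cB' gy'; apply: (cut2_star B'Q wQ cB' gy' gw fw).
have [phi0 [bdphi0 nz0]] := nz_flow cuts.
have [phi1 [bdphi1 nz1 _ [he hg]]] :=
  twist_star wQ w1Q wB w1w u3 u31 cw cw1 BQ cB fy bdphi0 nz0.
have u3' : uniq [:: e; g; f] by rewrite uniq3E eg ef eq_sym.
have cw' : cut [set w] = [set e; g; f] by rewrite cw -!setUA [[set f; g]]setUC.
have [phi [bdphi nz eq [me mf]]] :=
  twist_star wQ w2Q wB' w2w u3' u32 cw' cw2 B'Q cB' gy' bdphi1 nz1.
apply: (recolor_case cubic bdphi nz cQ ee' wQ w1Q w2Q w1w w2w u3 u31 u32 cw cw1 cw2)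
  => //; have hw1 : h \in cut [set w1] by rewrite cw1 !inE eqxx orbT.
  by rewrite (eq w1 h w1B' hw1) (eq w e wB' ew).
by rewrite (eq w1 h w1B' hw1) (eq w g wB' gw).
Qed.

End Star.

End Bridgeless.

(** Two configurations block [star_col] and are removed by induction on the size of [Q]: an edge
    between [w] and [w'], and a cut of size two pairing [e] with an edge other than [e']. *)
Lemma pendant_colP Q e e' :
  (forall u, u \in Q -> #|cut [set u]| = 3%N) ->
  (forall X, X \subset Q -> X != set0 -> (1 < #|cut X|)%N) ->
  cut Q = [set e; e'] -> e != e' -> pendant_col Q e e'.
Proof.
have [b] := ubnP #|Q|; elim: b => // b IH in Q e e' *; rewrite ltnS => Qb.
move=> cubic cuts cQ ee'.
have [eQ e'Q] : e \in cut Q /\ e' \in cut Q by rewrite cQ !inE !eqxx orbT.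
have [w wQ ew] := cut_end eQ; have [w' w'Q e'w'] := cut_end e'Q.
have ww' : w != w'.
  apply/eqP => ww'; rewrite -ww' in e'w'.
  exact: (cut2_star cubic cuts (subxx Q) wQ cQ ee' ew e'w').
have sub (Q1 : {set V}) x y : Q1 \proper Q -> cut Q1 = [set x; y] -> x != y ->
    pendant_col Q1 x y.
  move=> Q1Q cQ1 xy; have Q1sub := proper_sub Q1Q.
  apply: IH => // [|u uQ|X XQ]; first exact: leq_trans (proper_card Q1Q) Qb.
    by apply: cubic; apply: (subsetP Q1sub).
  by apply: cuts; apply: subset_trans Q1sub.
have e_w' : e \notin cut [set w'].
  by apply: contra ww' => ew'; rewrite (cut_end_uniq eQ wQ w'Q ew ew').
have e'_w : e' \notin cut [set w].
  by apply: contra ww' => e'w; rewrite (cut_end_uniq e'Q wQ w'Q e'w e'w').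
have [/existsP[f /andP[fw fw']]|nadj] := boolP [exists f, (f \in cut [set w]) &&
    (f \in cut [set w'])].
  have ef : e != f by apply: contraNneq e_w' => ->.
  have e'f : e' != f by apply: contraNneq e'_w => ->.
  have [g [u3 cw]] := cubic_split2 (cubic w wQ) ew fw ef.
  have [k [u3' cw']] := cubic_split2 (cubic w' w'Q) e'w' fw' e'f.
  have [gw kw'] : g \in cut [set w] /\ k \in cut [set w'].
    by rewrite cw cw' !inE !eqxx !orbT.
  have [_ eg fg] : [/\ e != f, e != g & f != g] by apply/and3P; rewrite -uniq3E.
  have [_ e'k fk] : [/\ e' != f, e' != k & f != k] by apply/and3P; rewrite -uniq3E.
  have ek : e != k by apply: contraNneq e_w' => ->.
  have e'g : e' != g by apply: contraNneq e'_w => ->.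
  (* Equality would give a second edge between [w] and [w']; this is where simplicity enters. *)
  have gk : g != k.
    apply: contra fg => /eqP gk; rewrite (simple ww' fw fw' gw) //.
    by rewrite gk.
  have u5 : uniq [:: e; e'; f; g; k].
    by rewrite uniq5E ee' ef eg ek e'f e'g e'k fg fk gk.
  apply: (adj_case wQ w'Q cw cw' u5 cQ ww'); apply: sub => //.
    apply: sub_proper_trans (properD1 wQ); exact: subD1set.
  apply/setP=> x; rewrite !cutD ?sub1set //; last first.
    by rewrite !inE eq_sym ww'.
  rewrite cQ cw cw' !inE.
  have [->|xe] := eqVneq x e; first by rewrite (negPf ee') (negPf ef) (negPf eg)
    (negPf ek).
  have [->|xe'] := eqVneq x e'; first by rewrite (negPf e'f) (negPf e'g) (negPf e'k).
  have [->|xf] := eqVneq x f; first by rewrite (negPf fg) (negPf fk).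
  by have [->|xg] := eqVneq x g; rewrite ?(negPf gk).
have [/existsP[Q1 /existsP[y /and4P[Q1Q ye ye' /eqP cQ1]]]|e_cut] :=
    boolP [exists Q1 : {set V}, [exists y,
      [&& Q1 \subset Q, y != e, y != e' & cut Q1 == [set e; y]]]].
  apply: (split_case cubic cuts Q1Q cQ cQ1 ee'); rewrite // 1?eq_sym //.
  apply: sub => //; last by rewrite eq_sym.
  rewrite properEneq Q1Q andbT; apply/eqP => Q1E.
  by move: e'Q; rewrite -Q1E cQ1 !inE eq_sym (negPf ee') eq_sym (negPf ye').
apply: (star_col cubic cuts cQ ee' ww' wQ ew w'Q e'w').
  move=> x xw; apply: contra nadj => xw'; apply/existsP; exists x.
  by rewrite xw.
move=> X y XQ ye cX; apply: contraNeq e_cut => ye'.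
by apply/existsP; exists X; apply/existsP; exists y; rewrite XQ ye ye' cX eqxx.
Qed.

End Coloring.

(** * Components of a simple graph *)

Section Components.
Variables (G : sgraph) (s t : edge G -> G).
Hypothesis valE : forall x : edge G, val x = [set s x; t x].
Hypothesis adj_st : forall x, adj (s x) (t x).
Hypothesis deg13 : forall v : G, degree v = 1 \/ degree v = 3.
Hypothesis bridge_pendant : forall f : edge G, bridge f ->
  exists2 v : G, v \in val f & degree v = 1.
Implicit Types (u v w : G) (x y : edge G) (X K : {set G}).

Local Notation cut := (cut s t).

Lemma st_neq x : s x != t x.
Proof. by apply: contraTneq (adj_st x) => ->; rewrite adj_irr. Qed.

Lemma cut1E v : cut [set v] = incident v.
Proof.
by apply/setP=> x; rewrite (endsE st_neq) inE valE !inE ![_ == v]eq_sym.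
Qed.

Lemma val_cut x v : (v \in val x) = (x \in cut [set v]).
Proof. by rewrite cut1E inE. Qed.

Lemma cut_simple u v x y : u != v -> x \in cut [set u] -> x \in cut [set v] ->
  y \in cut [set u] -> y \in cut [set v] -> x = y.
Proof.
rewrite -!val_cut => uv xu xv yu yv; apply: val_inj.
by rewrite (edge_eq uv xu xv) (edge_eq uv yu yv).
Qed.

Lemma adj_edge u v : adj u v ->
  exists x, [/\ val x = [set u; v], x \in cut [set u] & x \in cut [set v]].
Proof.
move=> uv; have xE : [set u; v] \in edges G.
  by apply/imset2P; exists u v; rewrite ?inE.
by exists (Sub [set u; v] xE); rewrite -!val_cut /= !inE !eqxx orbT.
Qed.

Lemma adj_csym : connect_sym (@adj G).
Proof. by apply: sym_connect_sym; apply: adj_sym. Qed.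

(** Deleting [f] separates its ends. Taking roots maps the components left after the deletion onto
    those of [G] and identifies the two containing the ends of [f], so it is not injective and the
    counts differ. *)
Lemma cut_bridge X f : cut X = [set f] -> bridge f.
Proof.
move=> cX; set e := del_edge f.
have esym : connect_sym e.
  by apply: sym_connect_sym => u v; rewrite /e /del_edge /= adj_sym setUC.
have sub : subrel (connect e) (connect (@adj G)).
  by apply: connect_sub => u v /andP[uv _]; apply: connect1.
have fX : f \in cut X by rewrite cX inE.
have closedX : closed e X.
  apply: intro_closed => // u v /andP[uv uvf] uX; apply: contraT => vX.
  have [x [xE xu xv]] := adj_edge uv.
  have : x \in cut X by apply: (cut_out st_neq uX vX).
  by rewrite cX inE => /eqP xf; rewrite -xf xE eqxx in uvf.
have nconn : ~~ connect e (s f) (t f).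
  apply/negP => /(closed_connect closedX) stX.
  by move: fX; rewrite inE stX eqxx.
pose g := root (@adj G).
have groot u : g (root e u) = g u.
  apply/eqP; rewrite /g root_connect; last exact: adj_csym.
  by rewrite adj_csym; apply/sub/connect_root.
have gE : g @: [set z | roots e z] = [set z | roots (@adj G) z].
  apply/setP=> z; rewrite inE; apply/imsetP/idP => [[u _ ->]|/eqP zr].
    exact/roots_root/adj_csym.
  exists (root e z); first by rewrite inE; apply: roots_root.
  by rewrite groot.
rewrite /bridge /n_comp_mem.
have cardE (r : rel G) : #|[predI roots r & predT]| = #|[set z | roots r z]|.
  by apply: eq_card => z; rewrite !inE andbT.
rewrite !cardE -gE ltn_neqAle leq_imset_card andbT.
apply/negP => /imset_injP inj; case/negP: nconn.
rewrite -(root_connect esym); apply/eqP/inj; rewrite ?inE ?roots_root //.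
rewrite !groot; apply/eqP; rewrite /g root_connect; last exact: adj_csym.
exact: connect1.
Qed.

Variable r : G.
Let K := [set u | connect (@adj G) r u].

Lemma cutK : cut K = set0.
Proof.
apply/setP=> x; rewrite [RHS]inE inE !inE; apply/negbTE; rewrite negbK.
by rewrite (same_connect_r adj_csym (connect1 (adj_st x))).
Qed.

Lemma cutK_closed X : X \subset K -> X != set0 -> cut X = set0 -> X = K.
Proof.
move=> XK /set0Pn[u uX] cX; apply/eqP; rewrite eqEsubset XK /=.
have closedX : closed (@adj G) X.
  apply: (intro_closed adj_csym) => v w vw vX; apply: contraT => wX.
  have [x [_ xv xw]] := adj_edge vw.
  by have := cut_out st_neq vX wX xv xw; rewrite cX inE.
apply/subsetP=> v; rewrite inE => rv.
have := subsetP XK u uX; rewrite inE => ru.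
rewrite -(closed_connect closedX (_ : connect _ u v)) //.
by rewrite adj_csym in ru; apply: connect_trans ru rv.
Qed.

Definition colors_well (c : edge G -> color) := [/\ forall x, c x != 0%R,
  forall u, u \in K -> {in cut [set u] &, injective c} &
  forall u v x, u \in K -> v \in K -> degree u = 3 -> degree v = 3 -> u != v ->
    x \in cut [set u] -> x \in cut [set v] ->
    nrm (c @: cut [set u]) (c @: cut [set v])].

Lemma leaf_cut u : degree u = 1 -> exists x, cut [set u] = [set x].
Proof. by rewrite cut1E => /eqP/cards1P. Qed.

Lemma leaf_inj u (c : edge G -> color) : degree u = 1 ->
  {in cut [set u] &, injective c}.
Proof.
by move=> /leaf_cut[y ->] x x'; rewrite !inE => /eqP -> /eqP ->.
Qed.

Lemma flow_colors phi : (forall x, phi x != 0%R) ->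
  (forall u, u \in K -> degree u = 3 -> boundary s t phi u = 0%R) ->
  colors_well phi.
Proof.
move=> nz bdphi; have fl u : u \in K -> degree u = 3 ->
    line (phi @: cut [set u]) /\ {in cut [set u] &, injective phi}.
  by move=> uK du; apply: flow_line (bdphi u uK du) nz _; rewrite cut1E.
split=> // [u uK|u v x uK vK du dv uv xu xv].
  by have [du|du] := deg13 u; [apply: leaf_inj|exact: (fl u uK du).2].
apply: (line_nrm (fl u uK du).1 (fl v vK dv).1 (x := phi x)); exact: imset_f.
Qed.

Let L := [set u in K | degree u == 1].

(** An empty cut would make [X] the whole component, and a cut with one edge is a bridge, hence
    pendant. The third hypothesis isolates this last possibility, which has a different reason to be
    absent for each number of leaves. *)
Lemma cuts_gt1 (Q : {set G}) : Q \subset K -> Q != K ->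
  (forall (X : {set G}) f v, X \subset Q -> X != set0 -> cut X = [set f] ->
     f \in cut [set v] -> v \in L -> False) ->
  forall X : {set G}, X \subset Q -> X != set0 -> 1 < #|cut X|.
Proof.
move=> QK nQK noleaf X XQ X0; have XK := subset_trans XQ QK.
rewrite ltnNge; apply/negP; case: (posnP #|cut X|) => [/eqP|c0 c1].
  rewrite cards_eq0 => /eqP /(cutK_closed XK X0) XE _; case/negP: nQK.
  by rewrite eqEsubset QK -XE.
have /cards1P[f cX] : #|cut X| == 1 by rewrite eqn_leq c1.
have [v vf dv] := bridge_pendant (cut_bridge cX).
rewrite val_cut in vf; apply: (noleaf X f v) => //; rewrite inE dv eqxx andbT.
have [u uX fu] : exists2 u, u \in X & f \in cut [set u].
  by apply: (cut_end st_neq); rewrite cX inE.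
apply: contraT => vK; have := cut_out st_neq (subsetP XK u uX) vK fu vf.
by rewrite cutK inE.
Qed.

Lemma degL u : u \in K -> u \notin L -> degree u = 3.
Proof.
by rewrite !inE => -> /=; case: (deg13 u) => ->.
Qed.

(** The leaves decide where conservation is not imposed. With none it is dropped at [r], where it
    follows because all boundaries in [K] sum to zero; with at least two it is dropped at the
    leaves; with exactly one, [v] is the extra vertex of [pendant_col] for [K] without [l] and
    [v]. *)
Lemma component_colors : exists c, colors_well c.
Proof.
have [/cards1P[l LE]|L1] := boolP (#|L| == 1).
  have [lK dl] : l \in K /\ degree l = 1.
    have lL : l \in L by rewrite LE inE.
    by move: lL; rewrite inE => /andP[? /eqP].
  have [f cl] := leaf_cut dl.
  have fl : f \in cut [set l] by rewrite cl inE.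
  have [|v [vK vl fv]] := other_end st_neq lK fl; first by rewrite cutK inE.
  have dv : degree v = 3.
    by apply: degL => //; rewrite LE inE.
  have [e [e' [u3 cv]]] : exists e e', uniq [:: f; e; e'] /\
      cut [set v] = [set f; e; e'].
    by apply: cubic_split fv; rewrite cut1E.
  have [fe fe' ee'] : [/\ f != e, f != e' & e != e'] by apply/and3P; rewrite -uniq3E.
  pose Q := K :\ l :\ v.
  have QK : Q \subset K by apply/subsetP=> u; rewrite /Q !in_setD1 => /and3P[].
  have vKl : v \in K :\ l by rewrite in_setD1 vl.
  have cQ : cut Q = [set e; e'].
    apply/setP=> x; rewrite !cutD ?sub1set // cutK cl cv in_set0 !in_setU !in_set1.
    by have [->|_] := eqVneq x f; rewrite ?(negPf fe) ?(negPf fe').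
  have cubicQ u : u \in Q -> #|cut [set u]| = 3.
    rewrite /Q in_setD1 in_setD1 => /and3P[_ ul uK]; rewrite cut1E.
    by apply: degL; rewrite // LE inE.
  have cuts : forall X : {set G}, X \subset Q -> X != set0 -> 1 < #|cut X|.
    apply: cuts_gt1 => //.
      by apply/eqP => /setP/(_ l); rewrite lK /Q !in_setD1 eqxx andbF.
    move=> X x u XQ X0 cX xu; rewrite LE inE => /eqP ul.
    move: xu; rewrite ul cl inE => /eqP xf.
    have [w wX fw] : exists2 w, w \in X & f \in cut [set w].
      by apply: (cut_end st_neq); rewrite cX xf inE.
    have lv : l != v by rewrite eq_sym.
    have := subsetP XQ w wX; rewrite /Q !in_setD1 => /and3P[wv wl _].
    by have := ends3 st_neq fl fv fw lv; rewrite (negPf wv) (negPf wl).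
  have [c [d [[nz inj nm] u4 ends]]] :=
    pendant_colP st_neq cut_simple cubicQ cuts cQ ee'.
  pose c1 x := if x == f then d else c x.
  have Kcases u : u \in K -> [|| u == l, u == v | u \in Q].
    by rewrite /Q !in_setD1 => ->; case: (u == l); case: (u == v).
  have fQ u : u \in Q -> f \notin cut [set u].
    rewrite /Q !in_setD1 => /and3P[uv ul _]; apply/negP => fu.
    have lv : l != v by rewrite eq_sym.
    by have := ends3 st_neq fl fv fu lv; rewrite (negPf uv) (negPf ul).
  have c1Q u : u \in Q -> {in cut [set u], c1 =1 c}.
    move=> uQ x xu; rewrite /c1 ifN //; apply: contraTneq xu => ->.
    exact: fQ.
  have S1 u : u \in Q -> c1 @: cut [set u] = c @: cut [set u].
    by move=> uQ; apply: eq_in_imset; apply: c1Q.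
  have Sv : c1 @: cut [set v] = [set c e; c e'; d].
    rewrite cv imset_set3 /c1 eqxx ![_ == f]eq_sym (negPf fe) (negPf fe').
    by rewrite -setUA setUC.
  have [d0 ed e'd cee'] : [/\ d != 0%R, c e != d, c e' != d & c e != c e'].
    by move: u4; rewrite uniq4E => /and5P[_ _ d0 -> /andP[-> ->]]; rewrite eq_sym.
  have mixed u x : u \in Q -> x \in cut [set u] -> x \in cut [set v] ->
      nrm (c1 @: cut [set u]) (c1 @: cut [set v]).
    move=> uQ xu xv; rewrite S1 // Sv; apply: ends => //.
    have : x \in [set f; e; e'] by rewrite -cv.
    rewrite !in_setU !in_set1 => /orP[/orP[]|] /eqP xE; rewrite -?xE ?xu ?orbT //.
    by rewrite xE (negPf (fQ u uQ)) in xu.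
  exists c1; split.
  - by move=> x; rewrite /c1; case: ifP.
  - move=> u /Kcases/or3P[/eqP ->|/eqP ->|uQ]; first exact: leaf_inj.
      rewrite cv; apply: inj_set3; rewrite /c1 eqxx ![_ == f]eq_sym (negPf fe)
        (negPf fe') uniq3E.
      by rewrite ![d == _]eq_sym ed e'd cee'.
    by move=> x y xu yu; rewrite !(c1Q u) //; apply: (inj u).
  - have l3 : degree l <> 3 by rewrite dl.
    move=> u w x /Kcases/or3P[/eqP ->|/eqP ->|uQ] // /Kcases/or3P[/eqP ->|/eqP ->|wQ]
      // du dw uw xu xw; rewrite ?eqxx // in uw *.
    + by rewrite nrmC; apply: mixed xw xu.
    + exact: mixed xu xw.
    + by rewrite !S1 //; apply: nm xu xw.
have [L0|/set0Pn[l lL]] := eqVneq L set0.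
  have rK : r \in K by rewrite inE connect0.
  have cuts : forall X : {set G}, X \subset K :\ r -> X != set0 -> 1 < #|cut X|.
    apply: cuts_gt1; rewrite ?subD1set //; last first.
      by move=> X f v _ _ _ _; rewrite L0 inE.
    by apply/eqP => /setP/(_ r); rewrite rK in_setD1 eqxx.
  have [phi [bdphi nz]] := nz_flow cuts; exists phi; apply: flow_colors => // u.
  move=> uK _; have [->|ur] := eqVneq u r; last first.
    by apply: bdphi; rewrite in_setD1 ur.
  have := sum_bd_cut2 s t char2B3 K phi; rewrite cutK big_set0 (big_setD1 r) //=.
  by rewrite [X in (_ + X)%R]big1 ?addr0.
have cuts : forall X : {set G}, X \subset K :\: L -> X != set0 -> 1 < #|cut X|.
  apply: cuts_gt1; rewrite ?subsetDl //.
    have lK : l \in K by move: lL; rewrite inE => /andP[].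
    by apply/eqP => /setP/(_ l); rewrite lK in_setD lL.
  move=> X f v XQ X0 cX fv vL.
  have XnL u : u \in L -> u \notin X.
    by move=> uL; apply/negP => /(subsetP XQ); rewrite inE uL.
  have [vK dv] : v \in K /\ degree v = 1.
    by move: vL; rewrite inE => /andP[? /eqP].
  have [w wL wv] : exists2 w, w \in L & w != v.
    apply/exists_inP; apply: contraR L1; rewrite negb_exists_in => /forall_inP Lv.
    apply/cards1P; exists v; apply/setP=> w; rewrite inE; apply/idP/eqP => [|-> //].
    by move/Lv; rewrite negbK => /eqP.
  (* With [v] added, [X] would have an empty cut and be the whole component, against the second leaf
     [w]. *)
  have XvK : symd X [set v] \subset K.
    by apply: symd_sub => //; apply: subset_trans XQ (subsetDl _ _).
  have cXv : cut (symd X [set v]) = set0.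
    have [y cv] := leaf_cut dv; apply/setP=> x; rewrite cut_symd cX cv.
    by move: fv; rewrite cv inE => /eqP ->; rewrite addbb inE.
  have Xv0 : symd X [set v] != set0.
    by apply/set0Pn; exists v; rewrite !inE eqxx (negPf (XnL v vL)).
  have := cutK_closed XvK Xv0 cXv => /setP/(_ w).
  have wK : w \in K by move: wL; rewrite inE => /andP[].
  by rewrite wK !inE (negPf wv) (negPf (XnL w wL)).
have [phi [bdphi nz]] := nz_flow cuts; exists phi; apply: flow_colors => // u.
move=> uK du; apply: bdphi; rewrite inE uK andbT; apply/negP.
by rewrite inE du andbF.
Qed.

End Components.

(** * From vectors to seven colors *)

Section SevenColors.
Local Open Scope ring_scope.

(** The list [colors] begins with 0, so nonzero vectors have indices 1 to 7 and the predecessor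
    lands in ['I_7]. *)
Definition ord_color (x : color) : 'I_7 := inord (index x colors).-1.

Lemma ord_color_inj : {in [pred x | x != 0] &, injective ord_color}.
Proof.
have idx x : x != 0 -> (0 < index x colors < 8)%N.
  move=> x0; rewrite -[8%N]/(size colors) index_mem mem_colors andbT lt0n.
  by apply: contra x0 => /eqP i0; rewrite -(nth_index 0 (mem_colors x)) i0.
move=> x y x0 y0 /(congr1 val).
have /andP[ix ix8] := idx x x0; have /andP[iy iy8] := idx y y0.
rewrite /= !inordK ?prednK // => /(congr1 S); rewrite !prednK // => ixy.
by rewrite -(nth_index 0 (mem_colors x)) ixy nth_index // mem_colors.
Qed.

End SevenColors.

Theorem theorem7 (G : sgraph)
    (deg13 : forall v : G, degree v = 1 \/ degree v = 3)
    (bridge_pendant : forall f : edge G, bridge f ->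
       exists2 v : G, v \in val f & degree v = 1) :
  normal_chromatic_index G <= 7 /\
  exists c : {ffun edge G -> 'I_7}, edge_coloring c /\
    forall x y : G, adj x y -> degree x <> 1 -> degree y <> 1 ->
      poor c x y \/ rich c x y.
Proof.
(* An arbitrary orientation of the edges, which turns [G] into a multigraph with end maps [s] and
   [t]. *)
have ex (x : edge G) : exists p : G * G, val x = [set p.1; p.2] /\ adj p.1 p.2.
  case: x => f /= fE; case/imset2P: (fE) => u v _.
  by rewrite inE => /andP[_ uv] ->; exists (u, v).
have [p pP] := fin_all_exists ex.
pose s x := (p x).1; pose t x := (p x).2.
have valE x : val x = [set s x; t x] := (pP x).1.
have adj_st x : adj (s x) (t x) := (pP x).2.
have [cc ccP] :=
  fin_all_exists (component_colors valE adj_st deg13 bridge_pendant).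
pose rt := root (@adj G).
(* Each edge takes its color from the coloring of its own component, named by the root; both ends
   have the same root. *)
pose c0 x := cc (rt (s x)) x.
have csym := @adj_csym G.
have inK u : u \in [set v | connect (@adj G) (rt u) v].
  by rewrite inE csym connect_root.
have rt_eq u v : connect (@adj G) u v -> rt u = rt v.
  by move=> uv; apply/eqP; rewrite /rt root_connect.
have c0E u : {in incident u, c0 =1 cc (rt u)}.
  move=> x; rewrite -(cut1E valE adj_st) (endsE (st_neq adj_st)) /c0.
  case/orP=> /eqP <- //; rewrite (rt_eq (s x) (t x)) //.
  exact/connect1/adj_st.
have S0 u : c0 @: incident u = cc (rt u) @: incident u.
  by apply: eq_in_imset; apply: c0E.
have c0nz x : c0 x != 0%R by have [nz _ _] := ccP (rt (s x)); apply: nz.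
pose c : {ffun edge G -> 'I_7} := [ffun x => ord_color (c0 x)].
have cS u : color_set c u = ord_color @: (c0 @: incident u).
  by rewrite -imset_comp; apply: eq_imset => x; rewrite ffunE.
have col : edge_coloring c.
  apply/forallP=> f; apply/forallP=> g; apply/implyP=> /andP[fg /set0Pn[v]].
  rewrite inE => /andP[fv gv]; apply: contra fg => /eqP; rewrite !ffunE.
  move/ord_color_inj => /(_ (c0nz f) (c0nz g)).
  have [fi gi] : f \in incident v /\ g \in incident v by rewrite !inE.
  rewrite (c0E v) // (c0E v g gi); have [_ inj _] := ccP (rt v).
  by move=> cfg; apply/eqP/(inj v (inK v)); rewrite ?(cut1E valE adj_st).
have pr u v : adj u v -> degree u = 3 -> degree v = 3 ->
    poor c u v || rich c u v.
  move=> uv du dv; have [_ _ nm] := ccP (rt u).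
  have uv' : u != v by apply: contraTneq uv => ->; rewrite adj_irr.
  have [x [_ xu xv]] := adj_edge valE adj_st uv.
  have rtE : rt v = rt u by apply/esym/rt_eq/connect1.
  have vK : v \in [set w | connect (@adj G) (rt u) w] by rewrite -rtE inK.
  have := nm u v x (inK u) vK du dv uv' xu xv.
  rewrite !(cut1E valE adj_st) /poor /rich !cS -imsetU !S0 rtE.
  rewrite card_in_imset // => a b; rewrite -imsetU => /imsetP[y _ ->] /imsetP[z _ ->].
  have [nz _ _] := ccP (rt u).
  by apply: ord_color_inj; apply: nz.
split; last first.
  exists c; split=> // u v uv du dv; apply/orP/pr => //.
    by case: (deg13 u).
  by case: (deg13 v).
rewrite /normal_chromatic_index; case: ex_minnP => m _; apply.
apply/existsP; exists c; rewrite /normal_edge_coloring col /=.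
apply/forallP=> u; apply/forallP=> v; apply/implyP=> /and3P[uv /eqP du /eqP dv].
exact: pr.
Qed.
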